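(* Let $\mathcal A$ be a regular multiplier Hopf algebroid with base weight $\mu$, let $\phi$ be a full and faithful left integral and $\psi$ a right integral on $\mathcal A$ adapted to $\mu$. Then there exists a unique multiplier $\delta_\psi\in M(A)$ such that $\psi=\delta_\psi\cdot\phi$, i.e. $\psi(a)=\phi(a\delta_\psi)$ for all $a\in A$, and this multiplier is invertible if and only if $\psi$ is full and faithful.
   Context: Conventions. Algebras are over $\mathbb C$ and need not be unital; products $XY$ of subspaces denote linear spans. An algebra $A$ is non-degenerate if $aA\neq 0\neq Aa$ for $a\ne 0$; $M(A)$ is its multiplier algebra. $A^\vee$ is the dual vector space. A functional $\omega$ on $D$ is faithful if $\omega(dD)\ne0\ne\omega(Dd)$ for all $d\neq 0$. Regular multiplier Hopf algebroids. Compatible left and right quantum graphs consist of a non-degenerate algebra $A$, commuting subalgebras $B,C\subseteq M(A)$ and anti-isomorphisms $S_B:B\to C$, $S_C:C\to B$ with $BA=AB=CA=AC=A$, such that (i) either every finite $F\subseteq A$ admits $e\in A$ with $ae=a$ for $a\in F$, or the left modules ${}_BA,{}_CA$ are flat; (ii) either every finite $F\subseteq A$ admits $e\in A$ with $ea=a$ for $a\in F$, or the right modules $A_B,A_C$ are flat. Quotients of $A\otimes A$ are defined by the relations (for $x\in B$, $y\in C$): $A\otimes_BA$: $ax\otimes b=a\otimes xb$; $A\otimes_CA$: $ay\otimes b=a\otimes yb$; $A\otimes^BA$: $xa\otimes b=a\otimes bx$; $A\otimes^CA$: $ya\otimes b=a\otimes by$; $A\otimes_lA$: $xa\otimes b=a\otimes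 S_B(x)b$; $A\otimes_rA$: $aS_C(y)\otimes b=a\otimes by$. A left comultiplication is a homomorphism $\Delta_B:A\to\mathrm{End}(A\otimes_lA)$ such that for each $a$ there are elements $\Delta_B(a)(1\otimes b)$, $\Delta_B(a)(b\otimes1)$ of $A\otimes_lA$ with $\Delta_B(a)(b\otimes c)=(\Delta_B(a)(1\otimes c))(b\otimes1)=(\Delta_B(a)(b\otimes1))(1\otimes c)$, and $\Delta_B(xyax'y')=(y\otimes x)\Delta_B(a)(y'\otimes x')$ for $x,x'\in B$, $y,y'\in C$, and $((\Delta_B\otimes\mathrm{id})(\Delta_B(b)(1\otimes c)))(a\otimes1\otimes1)=((\mathrm{id}\otimes\Delta_B)(\Delta_B(b)(a\otimes1)))(1\otimes1\otimes c)$. A right comultiplication is a homomorphism $\Delta_C:A\to\mathrm{End}(A\otimes_rA)^{op}$ (acting from the right) such that there are elements $(a\otimes1)\Delta_C(c),(1\otimes b)\Delta_C(c)\in A\otimes_rA$ with $(a\otimes b)\Delta_C(c)=(1\otimes b)((a\otimes1)\Delta_C(c))=(a\otimes1)((1\otimes b)\Delta_C(c))$, and $\Delta_C(xyax'y')=(y\otimes x)\Delta_C(a)(y'\otimes x')$, $(a\otimes1\otimes1)((\Delta_C\otimes\mathrm{id})((1\otimes c)\Delta_C(b)))=(1\otimes1\otimes c)((\mathrm{id}\otimes\Delta_C)((a\otimes1)\Delta_C(b)))$. These data form a multiplier bialgebroid $\mathcal A$ if also $((\Delta_B\otimes\mathrm{id})((1\otimes c)\Delta_C(b)))(a\otimes1\otimes1)=(1\otimes1\otimes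 c)((\mathrm{id}\otimes\Delta_C)(\Delta_B(b)(a\otimes1)))$ and $(a\otimes1\otimes1)((\Delta_C\otimes\mathrm{id})(\Delta_B(b)(1\otimes c)))=((\mathrm{id}\otimes\Delta_B)((a\otimes1)\Delta_C(b)))(1\otimes1\otimes c)$. It is a regular multiplier Hopf algebroid if the canonical maps $T_\lambda:A\otimes^CA\to A\otimes_lA$, $a\otimes b\mapsto\Delta_B(b)(a\otimes1)$; $T_\rho:A\otimes_BA\to A\otimes_lA$, $a\otimes b\mapsto\Delta_B(a)(1\otimes b)$; ${}_\lambda T:A\otimes_CA\to A\otimes_rA$, $a\otimes b\mapsto(a\otimes1)\Delta_C(b)$; ${}_\rho T:A\otimes^BA\to A\otimes_rA$, $a\otimes b\mapsto(1\otimes b)\Delta_C(a)$ are bijective. Sweedler notation: $\Delta_B(a)(1\otimes b)=\sum a_{(1)}\otimes a_{(2)}b$, $\Delta_B(b)(a\otimes 1)=\sum b_{(1)}a\otimes b_{(2)}$, $(a\otimes1)\Delta_C(b)=\sum ab_{(1)}\otimes b_{(2)}$, $(1\otimes b)\Delta_C(a)=\sum a_{(1)}\otimes ba_{(2)}$. There are then a unique left counit ${}_B\varepsilon:A\to B$ and right counit $\varepsilon_C:A\to C$ with ${}_B\varepsilon(xa)=x\,{}_B\varepsilon(a)$, ${}_B\varepsilon(S_B(x)a)={}_B\varepsilon(a)x$, $\sum S_B({}_B\varepsilon(a_{(1)}))a_{(2)}b=ab$, $\sum{}_B\varepsilon(b_{(2)})b_{(1)}a=ba$, ${}_B\varepsilon(ab)={}_B\varepsilon(a\,{}_B\varepsilon(b))={}_B\varepsilon(aS_B({}_B\varepsilon(b)))$,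 and $\varepsilon_C(ay)=\varepsilon_C(a)y$, $\varepsilon_C(aS_C(y))=y\varepsilon_C(a)$, $\sum ba_{(2)}\varepsilon_C(a_{(1)})=ba$, $\sum ab_{(1)}S_C(\varepsilon_C(b_{(2)}))=ab$, $\varepsilon_C(ab)=\varepsilon_C(\varepsilon_C(a)b)=\varepsilon_C(S_C(\varepsilon_C(a))b)$. Base weights and integrals. A base weight is a pair $\mu=(\mu_B,\mu_C)$ of faithful functionals on $B$ and $C$ with $\mu_B\circ S_C=\mu_C$, $\mu_C\circ S_B=\mu_B$, $\mu_B\circ{}_B\varepsilon=\mu_C\circ\varepsilon_C$. A functional $\omega\in A^\vee$ is adapted to $\mu$ if there are (necessarily unique) maps ${}_B\omega,\omega_B:A\to B$, ${}_C\omega,\omega_C:A\to C$ with $\omega(xa)=\mu_B(x\,{}_B\omega(a))$, $\omega(ax)=\mu_B(\omega_B(a)x)$, $\omega(ya)=\mu_C(y\,{}_C\omega(a))$, $\omega(ay)=\mu_C(\omega_C(a)y)$ for all $x\in B,y\in C,a\in A$. A left integral is an adapted $\phi$ with $\sum S_B^{-1}({}_C\phi(b_{(2)}))b_{(1)}a={}_C\phi(b)a$ for all $a,b$, equivalently $\sum ab_{(1)}S_C(\phi_C(b_{(2)}))=a\phi_C(b)$ for all $a,b$ (then ${}_C\phi=\phi_C$). A right integral is an adapted $\psi$ with $\sum S_B({}_B\psi(a_{(1)}))a_{(2)}b={}_B\psi(a)b$ for all $a,b$, equivalently $\sum ba_{(2)}S_C^{-1}(\psi_B(a_{(1)}))=b\psi_B(a)$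 for all $a,b$ (then ${}_B\psi=\psi_B$). A left integral $\phi$ is full if ${}_B\phi,\phi_B:A\to B$ are surjective; a right integral $\psi$ is full if ${}_C\psi,\psi_C:A\to C$ are surjective. *)

(* Defs.v *)
From HB Require Import structures.
From mathcomp Require Import all_boot all_order all_algebra.
From mathcomp Require Import boolp reals complex.

Set Implicit Arguments.
Unset Strict Implicit.
Unset Printing Implicit Defensive.

Import GRing.Theory.
Local Open Scope ring_scope.
Local Open Scope quotient_scope.

Reserved Notation "a ** b" (at level 40, left associativity).
Reserved Notation "x *> a" (at level 40, left associativity).
Reserved Notation "a <* x" (at level 40, left associativity).

(* MathComp's algebras are unital, so non-unital ones are set up here. *)
HB.mixin Record Lmodule_isNuAlgebra (K : fieldType) A of GRing.Lmodule K A := {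
  numul : A -> A -> A;
  numulA : associative numul;
  numulDl : left_distributive numul +%R;
  numulDr : right_distributive numul +%R;
  numulZl : forall (k : K) (a b : A), numul (k *: a) b = k *: numul a b;
  numulZr : forall (k : K) (a b : A), numul a (k *: b) = k *: numul a b
}.

#[short(type="nuAlgType")]
HB.structure Definition NuAlgebra (K : fieldType) :=
  {A of Lmodule_isNuAlgebra K A & GRing.Lmodule K A}.

Notation "a ** b" := (numul a b) : ring_scope.

Definition nondegenerate (K : fieldType) (A : nuAlgType K) : Prop :=
  forall a : A, a != 0 ->
    (exists b : A, a ** b != 0) /\ (exists b : A, b ** a != 0).

Definition faithful (K : fieldType) (D : nuAlgType K) (w : {scalar D}) : Prop :=
  forall d : D, d != 0 ->
    (exists e : D, w (d ** e) != 0) /\ (exists e : D, w (e ** d) != 0).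

Section Multipliers.
Variables (K : fieldType) (A : nuAlgType K).

(* A multiplier x is the pair of maps a |-> x a and a |-> a x. *)
Record is_multiplier (l r : A -> A) : Prop := IsMultiplier {
  lmult_linear : forall (k : K) a b, l (k *: a + b) = k *: l a + l b;
  rmult_linear : forall (k : K) a b, r (k *: a + b) = k *: r a + r b;
  lmult_mul : forall a b, l (a ** b) = l a ** b;
  rmult_mul : forall a b, r (a ** b) = a ** r b;
  lrmult : forall a b, a ** l b = r a ** b
}.

Record multiplier := Multiplier {
  lmult : A -> A;
  rmult : A -> A;
  multiplierP : is_multiplier lmult rmult
}.

Lemma multiplier_eq (x y : multiplier) :
  lmult x =1 lmult y -> rmult x =1 rmult y -> x = y.
Proof.
case: x y => [l r p] [l' r' p'] /= /funext ? /funext ?; subst l' r'.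
by rewrite (Prop_irrelevance p p').
Qed.

HB.instance Definition _ := gen_eqMixin multiplier.
HB.instance Definition _ := gen_choiceMixin multiplier.

Lemma mult_linE (f : A -> A) : (forall (k : K) a b, f (k *: a + b) = k *: f a + f b) ->
  [/\ f 0 = 0, {morph f : a b / a + b} & forall k, {morph f : a / k *: a}].
Proof.
move=> fl; have fD : {morph f : a b / a + b}.
  by move=> a b; have := fl 1 a b; rewrite !scale1r.
have f0 : f 0 = 0 by apply: (addrI (f 0)); rewrite -fD !addr0.
by split=> // k a; have := fl k a 0; rewrite f0 !addr0.
Qed.

Lemma numul0a (a : A) : 0 ** a = 0.
Proof. by apply: (addrI (0 ** a)); rewrite -numulDl !addr0. Qed.
Lemma numula0 (a : A) : a ** 0 = 0.
Proof. by apply: (addrI (a ** 0)); rewrite -numulDr !addr0. Qed.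
Lemma numulNl (a b : A) : (- a) ** b = - (a ** b).
Proof. by rewrite -!scaleN1r numulZl. Qed.
Lemma numulNr (a b : A) : a ** (- b) = - (a ** b).
Proof. by rewrite -!scaleN1r numulZr. Qed.

Fact mult0P : is_multiplier (fun=> 0) (fun=> 0).
Proof. by split=> *; rewrite ?scaler0 ?addr0 ?numul0a ?numula0. Qed.

Fact multNP (x : multiplier) :
  is_multiplier (fun a => - lmult x a) (fun a => - rmult x a).
Proof.
case: x => l r [ll rl lm rm lr] /=; split=> *.
- by rewrite ll opprD scalerN.
- by rewrite rl opprD scalerN.
- by rewrite lm numulNl.
- by rewrite rm numulNr.
- by rewrite numulNl numulNr lr.
Qed.

Fact multDP (x y : multiplier) : is_multiplier
  (fun a => lmult x a + lmult y a) (fun a => rmult x a + rmult y a).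
Proof.
case: x y => l r [ll rl lm rm lr] [l' r' [ll' rl' lm' rm' lr']] /=; split=> *.
- by rewrite ll ll' scalerDr addrACA.
- by rewrite rl rl' scalerDr addrACA.
- by rewrite lm lm' numulDl.
- by rewrite rm rm' numulDr.
- by rewrite numulDl numulDr lr lr'.
Qed.

Fact multZP (k : K) (x : multiplier) :
  is_multiplier (fun a => k *: lmult x a) (fun a => k *: rmult x a).
Proof.
case: x => l r [ll rl lm rm lr] /=; split=> *.
- by rewrite ll scalerDr !scalerA mulrC.
- by rewrite rl scalerDr !scalerA mulrC.
- by rewrite lm numulZl.
- by rewrite rm numulZr.
- by rewrite numulZl numulZr lr.
Qed.

Fact mult1P : is_multiplier id id.
Proof. by split. Qed.

Fact multMP (x y : multiplier) : is_multiplier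
  (fun a => lmult x (lmult y a)) (fun a => rmult y (rmult x a)).
Proof.
case: x y => l r [ll rl lm rm lr] [l' r' [ll' rl' lm' rm' lr']] /=; split=> *.
- by rewrite ll' ll.
- by rewrite rl rl'.
- by rewrite lm' lm.
- by rewrite rm rm'.
- by rewrite lr lr'.
Qed.

Definition mult0 := Multiplier mult0P.
Definition multN x := Multiplier (multNP x).
Definition multD x y := Multiplier (multDP x y).
Definition multZ k x := Multiplier (multZP k x).
Definition mult1 := Multiplier mult1P.
Definition multM x y := Multiplier (multMP x y).

Fact multDA : associative multD.
Proof. by move=> x y z; apply: multiplier_eq => a /=; rewrite addrA. Qed.
Fact multDC : commutative multD.
Proof. by move=> x y; apply: multiplier_eq => a /=; rewrite addrC. Qed.
Fact mult0D : left_id mult0 multD.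
Proof. by move=> x; apply: multiplier_eq => a /=; rewrite add0r. Qed.
Fact multND : left_inverse mult0 multN multD.
Proof. by move=> x; apply: multiplier_eq => a /=; rewrite addNr. Qed.
HB.instance Definition _ :=
  GRing.isZmodule.Build multiplier multDA multDC mult0D multND.

Fact multZA a b v : multZ a (multZ b v) = multZ (a * b) v.
Proof. by apply: multiplier_eq => c /=; rewrite scalerA. Qed.
Fact mult1Z : left_id 1 multZ.
Proof. by move=> x; apply: multiplier_eq => c /=; rewrite scale1r. Qed.
Fact multZDr : right_distributive multZ +%R.
Proof. by move=> k x y; apply: multiplier_eq => c /=; rewrite scalerDr. Qed.
Fact multZDl v : {morph multZ^~ v : a b / a + b}.
Proof. by move=> a b; apply: multiplier_eq => c /=; rewrite scalerDl. Qed.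
HB.instance Definition _ := GRing.Zmodule_isLmodule.Build K multiplier
  multZA mult1Z multZDr multZDl.

Fact multMA : associative multM.
Proof. by move=> x y z; apply: multiplier_eq. Qed.
Fact mult1M : left_id mult1 multM.
Proof. by move=> x; apply: multiplier_eq. Qed.
Fact multM1 : right_id mult1 multM.
Proof. by move=> x; apply: multiplier_eq. Qed.
Fact multMDl : left_distributive multM +%R.
Proof.
move=> x y z; apply: multiplier_eq => a //=.
by have [_ -> _] := mult_linE (rmult_linear (multiplierP z)).
Qed.
Fact multMDr : right_distributive multM +%R.
Proof.
move=> x y z; apply: multiplier_eq => a //=.
by have [_ -> _] := mult_linE (lmult_linear (multiplierP x)).
Qed.
HB.instance Definition _ := GRing.Zmodule_isPzRing.Build multiplier
  multMA mult1M multM1 multMDl multMDr.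

Definition invertible (x : multiplier) : Prop :=
  exists y : multiplier, x * y = 1 /\ y * x = 1.

End Multipliers.

Notation "x *> a" := (lmult x a) : ring_scope.
Notation "a <* x" := (rmult x a) : ring_scope.

(* [tens f g] is the quotient of the tensor product of M and N over K by the
   relations f i m (x) n = m (x) g i n.  The list [:: (m1, n1); ...; (mr, nr)]
   stands for m1 (x) n1 + ... + mr (x) nr. *)
Section Tensor.
Variables (K : fieldType) (M N : lmodType K).
Variables (I : Type) (f : I -> M -> M) (g : I -> N -> N).

Inductive tensor_eq : seq (M * N) -> seq (M * N) -> Prop :=
| tensor_eq_refl s : tensor_eq s s
| tensor_eq_sym s t : tensor_eq s t -> tensor_eq t s
| tensor_eq_trans s t u : tensor_eq s t -> tensor_eq t u -> tensor_eq s u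
| tensor_eq_cat s s' t t' :
    tensor_eq s s' -> tensor_eq t t' -> tensor_eq (s ++ t) (s' ++ t')
| tensor_eq_catC s t : tensor_eq (s ++ t) (t ++ s)
| tensor_eq_0 n : tensor_eq [:: (0, n)] [::]
| tensor_eq_Dl m m' n : tensor_eq [:: (m + m', n)] [:: (m, n); (m', n)]
| tensor_eq_Dr m n n' : tensor_eq [:: (m, n + n')] [:: (m, n); (m, n')]
| tensor_eq_Z (k : K) m n : tensor_eq [:: (k *: m, n)] [:: (m, k *: n)]
(* the scalar k makes the relations stable under scaling for arbitrary f, g *)
| tensor_eq_bal (k : K) i m n :
    tensor_eq [:: (k *: f i m, n)] [:: (k *: m, g i n)].

Definition tensor_eqb s t := `[< tensor_eq s t >].

Fact tensor_eqb_refl : reflexive tensor_eqb.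
Proof. by move=> s; apply/asboolP; apply: tensor_eq_refl. Qed.
Fact tensor_eqb_sym : symmetric tensor_eqb.
Proof.
by move=> s t; apply/idP/idP => /asboolP /tensor_eq_sym h; apply/asboolP.
Qed.
Fact tensor_eqb_trans : transitive tensor_eqb.
Proof.
move=> t s u /asboolP h /asboolP h'; apply/asboolP.
exact: tensor_eq_trans h h'.
Qed.

Canonical tensor_equiv :=
  EquivRel tensor_eqb tensor_eqb_refl tensor_eqb_sym tensor_eqb_trans.

Definition tens := {eq_quot tensor_equiv}.

HB.instance Definition _ := Choice.on tens.
HB.instance Definition _ := EqQuotient.on tens.

Lemma tens_eq s t : tensor_eq s t -> \pi_tens s = \pi_tens t.
Proof. by move=> /asboolP st; apply/(@eqmodP _ tensor_equiv). Qed.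

Lemma tens_repr s : tensor_eq (repr (\pi_tens s)) s.
Proof.
apply/asboolP; change (tensor_equiv (repr (\pi_tens s)) s).
by apply/eqmodP; exact: (@reprK _ tens).
Qed.

Lemma tensW (P : tens -> Prop) : (forall s, P (\pi_tens s)) -> forall x, P x.
Proof. by move=> h x; rewrite -[x](@reprK _ tens). Qed.

Definition tensor_scale (k : K) (s : seq (M * N)) :=
  [seq (k *: p.1, p.2) | p <- s].

Lemma tensor_scale_eq k s t :
  tensor_eq s t -> tensor_eq (tensor_scale k s) (tensor_scale k t).
Proof.
elim=> {s t} /=.
- by move=> s; apply: tensor_eq_refl.
- by move=> s t _; apply: tensor_eq_sym.
- by move=> s t u _ h _; apply: tensor_eq_trans.
- by move=> s s' t t' _ h _ h'; rewrite /tensor_scale !map_cat;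
    apply: tensor_eq_cat.
- by move=> s t; rewrite /tensor_scale !map_cat; apply: tensor_eq_catC.
- by move=> n; rewrite scaler0; apply: tensor_eq_0.
- by move=> m m' n; rewrite scalerDr; apply: tensor_eq_Dl.
- by move=> m n n'; apply: tensor_eq_Dr.
- by move=> l m n; rewrite scalerA mulrC -scalerA; apply: tensor_eq_Z.
- by move=> l i m n; rewrite !scalerA; apply: tensor_eq_bal.
Qed.

Definition tens0 : tens := \pi_tens [::].
Definition tensD (x y : tens) : tens := \pi_tens (repr x ++ repr y).
Definition tensZ (k : K) (x : tens) : tens := \pi_tens (tensor_scale k (repr x)).
Definition tensN (x : tens) : tens := tensZ (-1) x.

Lemma tensD_pi s t : tensD (\pi_tens s) (\pi_tens t) = \pi_tens (s ++ t).
Proof. by apply/tens_eq/tensor_eq_cat; apply: tens_repr. Qed.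
Lemma tensZ_pi k s : tensZ k (\pi_tens s) = \pi_tens (tensor_scale k s).
Proof. by apply/tens_eq/tensor_scale_eq/tens_repr. Qed.

Fact tensDA : associative tensD.
Proof.
by elim/tensW=> s; elim/tensW=> t; elim/tensW=> u; rewrite !tensD_pi catA.
Qed.
Fact tensDC : commutative tensD.
Proof.
elim/tensW=> s; elim/tensW=> t; rewrite !tensD_pi.
by apply/tens_eq/tensor_eq_catC.
Qed.
Fact tens0D : left_id tens0 tensD.
Proof. by elim/tensW=> s; rewrite tensD_pi. Qed.

Lemma tensZ_cons k m n s : tensZ k (\pi_tens ((m, n) :: s)) =
  tensD (\pi_tens [:: (k *: m, n)]) (tensZ k (\pi_tens s)).
Proof. by rewrite !tensZ_pi tensD_pi. Qed.

Fact tensZDl v : {morph tensZ^~ v : a b / a + b >-> tensD a b}.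
Proof.
move=> a b; elim/tensW: v; elim=> [|[m n] s ih].
  by rewrite !tensZ_pi tensD_pi.
rewrite !tensZ_cons ih scalerDl (tens_eq (tensor_eq_Dl _ _ _)).
rewrite -[[:: (_, n); _]]/([:: (a *: m, n)] ++ [:: (b *: m, n)]) -tensD_pi.
rewrite -!tensDA; congr tensD; rewrite !tensDA; congr tensD.
by rewrite tensDC.
Qed.

Lemma tens0Z v : tensZ 0 v = tens0.
Proof.
elim/tensW: v; elim=> [|[m n] s ih]; first by rewrite tensZ_pi.
by rewrite tensZ_cons ih scale0r (tens_eq (tensor_eq_0 _)) tensD_pi.
Qed.

Fact tens1Z : left_id 1 tensZ.
Proof.
elim/tensW=> s; rewrite tensZ_pi; congr (\pi_tens _).
by rewrite -[RHS]map_id; apply: eq_map => -[m n] /=; rewrite scale1r.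
Qed.

Fact tensND : left_inverse tens0 tensN tensD.
Proof.
by move=> v; rewrite -{2}[v]tens1Z /tensN -tensZDl addNr tens0Z.
Qed.

HB.instance Definition _ :=
  GRing.isZmodule.Build tens tensDA tensDC tens0D tensND.

Fact tensZA a b v : tensZ a (tensZ b v) = tensZ (a * b) v.
Proof.
elim/tensW: v => s; rewrite !tensZ_pi; congr (\pi_tens _).
by rewrite /tensor_scale -map_comp; apply: eq_map => -[m n] /=; rewrite scalerA.
Qed.
Fact tensZDr : right_distributive tensZ +%R.
Proof.
move=> k; elim/tensW=> s; elim/tensW=> t.
rewrite [X in tensZ _ X]tensD_pi !tensZ_pi /tensor_scale map_cat.
by rewrite -tensD_pi.
Qed.

HB.instance Definition _ := GRing.Zmodule_isLmodule.Build K tens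
  tensZA tens1Z tensZDr tensZDl.

Definition tensor (m : M) (n : N) : tens := \pi_tens [:: (m, n)].

Record balanced (V : lmodType K) (beta : M -> N -> V) : Prop := Balanced {
  balanced_Dl : forall m m' n, beta (m + m') n = beta m n + beta m' n;
  balanced_Dr : forall m n n', beta m (n + n') = beta m n + beta m n';
  balanced_Zl : forall (k : K) m n, beta (k *: m) n = k *: beta m n;
  balanced_Zr : forall (k : K) m n, beta m (k *: n) = k *: beta m n;
  balanced_bal : forall i m n, beta (f i m) n = beta m (g i n)
}.

(* The linear map m (x) n |-> beta m n.  It is meaningful when beta is
   balanced: see [tmap_tensor] and [tmap_linear]. *)
Definition tmap (V : lmodType K) (beta : M -> N -> V) (t : tens) : V :=
  \sum_(p <- repr t) beta p.1 p.2.

Lemma tmap_pi (V : lmodType K) (beta : M -> N -> V) : balanced beta ->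
  forall s, tmap beta (\pi_tens s) = \sum_(p <- s) beta p.1 p.2.
Proof.
move=> [Dl Dr Zl Zr bal] s; rewrite /tmap.
suff sum_eq s' t : tensor_eq s' t ->
  \sum_(p <- s') beta p.1 p.2 = \sum_(p <- t) beta p.1 p.2.
  exact: sum_eq (tens_repr s).
elim=> {s s' t} //=.
- by move=> s t u _ -> _ ->.
- by move=> s s' t t' _ h _ h'; rewrite !big_cat /= h h'.
- by move=> s t; rewrite !big_cat /= addrC.
- by move=> n; rewrite big_seq1 big_nil /= -(scale0r 0) Zl scale0r.
- by move=> m m' n; rewrite !big_cons !big_nil /= !addr0 Dl.
- by move=> m n n'; rewrite !big_cons !big_nil /= !addr0 Dr.
- by move=> k m n; rewrite !big_seq1 /= Zl Zr.
- by move=> k i m n; rewrite !big_seq1 /= !Zl bal.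
Qed.

Lemma tmap_tensor (V : lmodType K) (beta : M -> N -> V) : balanced beta ->
  forall m n, tmap beta (tensor m n) = beta m n.
Proof. by move=> h m n; rewrite tmap_pi // big_seq1. Qed.

Lemma tmap_linear (V : lmodType K) (beta : M -> N -> V) : balanced beta ->
  linear (tmap beta).
Proof.
move=> h k; elim/tensW=> s; elim/tensW=> t.
rewrite [X in X + _]tensZ_pi [X in tmap _ X]tensD_pi !tmap_pi //.
rewrite big_cat /= scaler_sumr big_map /=; congr (_ + _).
by apply: eq_bigr => p _ /=; rewrite (balanced_Zl h).
Qed.

End Tensor.

Arguments balanced {K M N I} f g {V} beta.
Arguments tensor {K M N I} f g m n.
Arguments tmap {K M N I f g V} beta t.

Definition tbimap (K : fieldType) (M N : lmodType K) (I : Type)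
    (f : I -> M -> M) (g : I -> N -> N) (u : M -> M) (v : N -> N) :
    tens f g -> tens f g :=
  tmap (fun m n => tensor f g (u m) (v n)).

(* That beta1 and beta2 descend to the tensor products is part of the
   condition: otherwise the two sides are not meaningful. *)
Definition same_image (K : fieldType) (V : lmodType K)
    (M1 N1 : lmodType K) (I1 : Type) (f1 : I1 -> M1 -> M1) (g1 : I1 -> N1 -> N1)
    (beta1 : M1 -> N1 -> V) (t1 : tens f1 g1)
    (M2 N2 : lmodType K) (I2 : Type) (f2 : I2 -> M2 -> M2) (g2 : I2 -> N2 -> N2)
    (beta2 : M2 -> N2 -> V) (t2 : tens f2 g2) : Prop :=
  [/\ balanced f1 g1 beta1, balanced f2 g2 beta2 &
      tmap beta1 t1 = tmap beta2 t2].

Definition induces_bijection (K : fieldType) (M N V : lmodType K) (I : Type)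
    (f : I -> M -> M) (g : I -> N -> N) (beta : M -> N -> V) : Prop :=
  balanced f g beta /\ bijective (tmap beta : tens f g -> V).

Section Flatness.
Variables (K : fieldType) (B : nuAlgType K).

Record right_action (N : lmodType K) (r : N -> B -> N) : Prop := RightAction {
  right_action_Dl : forall n n' x, r (n + n') x = r n x + r n' x;
  right_action_Dr : forall n x x', r n (x + x') = r n x + r n x';
  right_action_Zl : forall (k : K) n x, r (k *: n) x = k *: r n x;
  right_action_Zr : forall (k : K) n x, r n (k *: x) = k *: r n x;
  right_action_M : forall n x x', r n (x ** x') = r (r n x) x'
}.

Record left_action (N : lmodType K) (l : B -> N -> N) : Prop := LeftAction {
  left_action_Dl : forall x x' n, l (x + x') n = l x n + l x' n;
  left_action_Dr : forall x n n', l x (n + n') = l x n + l x n';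
  left_action_Zl : forall (k : K) x n, l (k *: x) n = k *: l x n;
  left_action_Zr : forall (k : K) x n, l x (k *: n) = k *: l x n;
  left_action_M : forall x x' n, l (x ** x') n = l x (l x' n)
}.

(* B need not be unital, so flatness is tested on all modules, without any
   unitality condition. *)
Definition left_flat (A : lmodType K) (l : B -> A -> A) : Prop :=
  forall (N N' : lmodType K) (r : N -> B -> N) (r' : N' -> B -> N'),
  right_action r -> right_action r' ->
  forall j : {linear N -> N'},
  (forall n x, j (r n x) = r' (j n) x) -> injective j ->
  injective (tmap (fun n a => tensor (fun x n' => r' n' x) l (j n) a)
             : tens (fun x n => r n x) l -> tens (fun x n' => r' n' x) l).

Definition right_flat (A : lmodType K) (r : A -> B -> A) : Prop :=
  forall (N N' : lmodType K) (l : B -> N -> N) (l' : B -> N' -> N'),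
  left_action l -> left_action l' ->
  forall j : {linear N -> N'},
  (forall x n, j (l x n) = l' x (j n)) -> injective j ->
  injective (tmap (fun a n => tensor (fun x a' => r a' x) l' a (j n))
             : tens (fun x a => r a x) l -> tens (fun x a => r a x) l').

End Flatness.

(* The subalgebras B, C of M(A) are given as algebras together with injective
   homomorphisms iB, iC into M(A). *)
Record quantum_graphs (K : fieldType) := QuantumGraphs {
  qgA : nuAlgType K;
  qgB : nuAlgType K;
  qgC : nuAlgType K;
  qg_nondegenerate : nondegenerate qgA;
  iB : {linear qgB -> multiplier qgA};
  iC : {linear qgC -> multiplier qgA};
  iB_inj : injective iB;
  iC_inj : injective iC;
  iBM : forall x x', iB (x ** x') = iB x * iB x';
  iCM : forall y y', iC (y ** y') = iC y * iC y';
  iBC_comm : forall x y, iB x * iC y = iC y * iB x;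
  SB : {linear qgB -> qgC};
  SC : {linear qgC -> qgB};
  SBinv : qgC -> qgB;
  SCinv : qgB -> qgC;
  SBK : cancel SB SBinv;
  SBinvK : cancel SBinv SB;
  SCK : cancel SC SCinv;
  SCinvK : cancel SCinv SC;
  SB_anti : forall x x', SB (x ** x') = SB x' ** SB x;
  SC_anti : forall y y', SC (y ** y') = SC y' ** SC y;
  qgBA : forall a, exists s : seq (qgB * qgA), a = \sum_(p <- s) iB p.1 *> p.2;
  qgAB : forall a, exists s : seq (qgA * qgB), a = \sum_(p <- s) p.1 <* iB p.2;
  qgCA : forall a, exists s : seq (qgC * qgA), a = \sum_(p <- s) iC p.1 *> p.2;
  qgAC : forall a, exists s : seq (qgA * qgC), a = \sum_(p <- s) p.1 <* iC p.2;
  qg_left :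
    (forall F : seq qgA, exists e : qgA, forall a, a \in F -> a ** e = a) \/
    left_flat (fun x a => iB x *> a) /\ left_flat (fun y a => iC y *> a);
  qg_right :
    (forall F : seq qgA, exists e : qgA, forall a, a \in F -> e ** a = a) \/
    right_flat (fun a x => a <* iB x) /\ right_flat (fun a y => a <* iC y)
}.

Section TensorProducts.
Variables (K : fieldType) (Q : quantum_graphs K).
Local Notation A := (qgA Q).
Local Notation B := (qgB Q).
Local Notation C := (qgC Q).
Local Notation iB := (@iB K Q).
Local Notation iC := (@iC K Q).
Local Notation SB := (@SB K Q).
Local Notation SC := (@SC K Q).

Definition lB (x : B) (a : A) : A := iB x *> a.
Definition rB (x : B) (a : A) : A := a <* iB x.
Definition lC (y : C) (a : A) : A := iC y *> a.
Definition rC (y : C) (a : A) : A := a <* iC y.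
Definition lSB (x : B) (a : A) : A := iC (SB x) *> a.
Definition rSC (y : C) (a : A) : A := a <* iB (SC y).

Definition tens_l := tens lB lSB.
Definition tens_r := tens rSC rC.

Definition el_l : A -> A -> tens_l := tensor lB lSB.
Definition el_r : A -> A -> tens_r := tensor rSC rC.

(* A (x)_l A (x)_l A, A (x)_r A (x)_r A, A (x)_l A (x)_r A and
   A (x)_r A (x)_l A, the last tensor product being formed with respect to
   the second leg of the first one. *)
Definition tens_ll := tens (fun x (t : tens_l) => tbimap id (lB x) t) lSB.
Definition tens_rr := tens (fun y (t : tens_r) => tbimap id (rSC y) t) rC.
Definition tens_lr := tens (fun y (t : tens_l) => tbimap id (rSC y) t) rC.
Definition tens_rl := tens (fun x (t : tens_r) => tbimap id (lB x) t) lSB.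

Definition el_ll (t : tens_l) (c : A) : tens_ll := tensor _ _ t c.
Definition el_rr (t : tens_r) (c : A) : tens_rr := tensor _ _ t c.
Definition el_lr (t : tens_l) (c : A) : tens_lr := tensor _ _ t c.
Definition el_rl (t : tens_r) (c : A) : tens_rl := tensor _ _ t c.

(* a (x) (p (x) q) = (a (x) p) (x) q *)
Definition cons_ll (a : A) (t : tens_l) : tens_ll :=
  tmap (fun p q => el_ll (el_l a p) q) t.
Definition cons_rr (a : A) (t : tens_r) : tens_rr :=
  tmap (fun p q => el_rr (el_r a p) q) t.
Definition cons_lr (a : A) (t : tens_r) : tens_lr :=
  tmap (fun p q => el_lr (el_l a p) q) t.
Definition cons_rl (a : A) (t : tens_l) : tens_rl :=
  tmap (fun p q => el_rl (el_r a p) q) t.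

Definition sandwich (x : B) (y : C) (a : A) (x' : B) (y' : C) : A :=
  (iB x *> (iC y *> a)) <* iB x' <* iC y'.

End TensorProducts.

(* DeltaB_l b a = Delta_B(b)(a (x) 1),   DeltaB_r a b = Delta_B(a)(1 (x) b),
   DeltaC c t = t Delta_C(c),
   DeltaC_l a c = (a (x) 1)Delta_C(c),   DeltaC_r b c = (1 (x) b)Delta_C(c). *)
Record multiplier_bialgebroid (K : fieldType) (Q : quantum_graphs K) :=
MultiplierBialgebroid {
  DeltaB : qgA Q -> {linear tens_l Q -> tens_l Q};
  DeltaB_l : qgA Q -> qgA Q -> tens_l Q;
  DeltaB_r : qgA Q -> qgA Q -> tens_l Q;
  DeltaB_linear : forall (k : K) a a' t,
    DeltaB (k *: a + a') t = k *: DeltaB a t + DeltaB a' t;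
  DeltaBM : forall a a' t, DeltaB (a ** a') t = DeltaB a (DeltaB a' t);
  DeltaB_rE : forall a b c,
    DeltaB a (el_l b c) = tbimap (fun d => d ** b) id (DeltaB_r a c);
  DeltaB_lE : forall a b c,
    DeltaB a (el_l b c) = tbimap id (fun d => d ** c) (DeltaB_l a b);
  DeltaB_bimod : forall x y a x' y' t,
    DeltaB (sandwich x y a x' y') t =
    tbimap (lC y) (lB x) (DeltaB a (tbimap (lC y') (lB x') t));
  DeltaB_coassoc : forall a b c,
    same_image
      (fun d e => el_ll (DeltaB_l d a) e) (DeltaB_r b c)
      (fun d e => cons_ll d (DeltaB_r e c)) (DeltaB_l b a);
  DeltaC : qgA Q -> {linear tens_r Q -> tens_r Q};
  DeltaC_l : qgA Q -> qgA Q -> tens_r Q;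
  DeltaC_r : qgA Q -> qgA Q -> tens_r Q;
  DeltaC_linear : forall (k : K) a a' t,
    DeltaC (k *: a + a') t = k *: DeltaC a t + DeltaC a' t;
  DeltaCM : forall a a' t, DeltaC (a ** a') t = DeltaC a' (DeltaC a t);
  DeltaC_lE : forall a b c,
    DeltaC c (el_r a b) = tbimap id (fun d => b ** d) (DeltaC_l a c);
  DeltaC_rE : forall a b c,
    DeltaC c (el_r a b) = tbimap (fun d => a ** d) id (DeltaC_r b c);
  DeltaC_bimod : forall x y a x' y' t,
    DeltaC (sandwich x y a x' y') t =
    tbimap (rC y') (rB x') (DeltaC a (tbimap (rC y) (rB x) t));
  DeltaC_coassoc : forall a b c,
    same_image
      (fun d e => el_rr (DeltaC_l a d) e) (DeltaC_r c b)
      (fun d e => cons_rr d (DeltaC_r c e)) (DeltaC_l a b);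
  DeltaBC_coassoc : forall a b c,
    same_image
      (fun d e => el_lr (DeltaB_l d a) e) (DeltaC_r c b)
      (fun d e => cons_lr d (DeltaC_r c e)) (DeltaB_l b a);
  DeltaCB_coassoc : forall a b c,
    same_image
      (fun d e => el_rl (DeltaC_l a d) e) (DeltaB_r b c)
      (fun d e => cons_rl d (DeltaB_r e c)) (DeltaC_l a b)
}.

Section HopfAlgebroids.
Variables (K : fieldType) (Q : quantum_graphs K) (D : multiplier_bialgebroid Q).
Local Notation A := (qgA Q).
Local Notation B := (qgB Q).
Local Notation C := (qgC Q).
Local Notation iB := (@iB K Q).
Local Notation iC := (@iC K Q).
Local Notation SB := (@SB K Q).
Local Notation SC := (@SC K Q).

(* The canonical maps, on A (x)^C A, A (x)_B A, A (x)_C A and A (x)^B A. *)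
Record regular_multiplier_hopf_algebroid : Prop := RegularMHA {
  T_lambda : induces_bijection (@lC K Q) (@rC K Q)
    (fun a b => DeltaB_l D b a);
  T_rho : induces_bijection (@rB K Q) (@lB K Q)
    (fun a b => DeltaB_r D a b);
  lambda_T : induces_bijection (@rC K Q) (@lC K Q)
    (fun a b => DeltaC_l D a b);
  rho_T : induces_bijection (@lB K Q) (@rB K Q)
    (fun a b => DeltaC_r D b a)
}.

Record left_counit (epsB : A -> B) : Prop := LeftCounit {
  epsB_linear : linear epsB;
  epsB_lB : forall x a, epsB (iB x *> a) = x ** epsB a;
  epsB_lSB : forall x a, epsB (iC (SB x) *> a) = epsB a ** x;
  epsB_counit_r : forall a b,
    tmap (fun d e => iC (SB (epsB d)) *> e) (DeltaB_r D a b) = a ** b;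
  epsB_counit_l : forall a b,
    tmap (fun d e => iB (epsB e) *> d) (DeltaB_l D b a) = b ** a;
  epsB_mul : forall a b, epsB (a ** b) = epsB (a <* iB (epsB b));
  epsB_mulS : forall a b, epsB (a ** b) = epsB (a <* iC (SB (epsB b)))
}.

Record right_counit (epsC : A -> C) : Prop := RightCounit {
  epsC_linear : linear epsC;
  epsC_rC : forall a y, epsC (a <* iC y) = epsC a ** y;
  epsC_rSC : forall a y, epsC (a <* iB (SC y)) = y ** epsC a;
  epsC_counit_r : forall a b,
    tmap (fun d e => e <* iC (epsC d)) (DeltaC_r D b a) = b ** a;
  epsC_counit_l : forall a b,
    tmap (fun d e => d <* iB (SC (epsC e))) (DeltaC_l D a b) = a ** b;
  epsC_mul : forall a b, epsC (a ** b) = epsC (iC (epsC a) *> b);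
  epsC_mulS : forall a b, epsC (a ** b) = epsC (iB (SC (epsC a)) *> b)
}.

Record base_weight (epsB : A -> B) (epsC : A -> C)
    (muB : {scalar B}) (muC : {scalar C}) : Prop := BaseWeight {
  muB_faithful : faithful muB;
  muC_faithful : faithful muC;
  muB_SC : forall y, muB (SC y) = muC y;
  muC_SB : forall x, muC (SB x) = muB x;
  mu_counit : forall a, muB (epsB a) = muC (epsC a)
}.

Section Integrals.
Variables (muB : {scalar B}) (muC : {scalar C}).

(* The maps Bw, wB : A -> B and Cw, wC : A -> C attached to an adapted
   functional w; [fac_B_ p] is Bw, [fac__B p] is wB, etc. *)
Record factors := Factors {
  fac_B_ : A -> B;
  fac__B : A -> B;
  fac_C_ : A -> C;
  fac__C : A -> C
}.

Record adapted (w : {scalar A}) (p : factors) : Prop := Adapted {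
  adapted_B_ : forall x a, w (iB x *> a) = muB (x ** fac_B_ p a);
  adapted__B : forall x a, w (a <* iB x) = muB (fac__B p a ** x);
  adapted_C_ : forall y a, w (iC y *> a) = muC (y ** fac_C_ p a);
  adapted__C : forall y a, w (a <* iC y) = muC (fac__C p a ** y)
}.

Definition left_integral (phi : {scalar A}) : Prop :=
  exists2 p, adapted phi p & forall a b,
    tmap (fun d e => iB (SBinv (fac_C_ p e)) *> d) (DeltaB_l D b a) =
    iC (fac_C_ p b) *> a.

Definition right_integral (psi : {scalar A}) : Prop :=
  exists2 p, adapted psi p & forall a b,
    tmap (fun d e => iC (SB (fac_B_ p d)) *> e) (DeltaB_r D a b) =
    iB (fac_B_ p a) *> b.

Definition full_left_integral (phi : {scalar A}) : Prop :=
  left_integral phi /\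
  exists2 p, adapted phi p &
    (forall x, exists a, fac_B_ p a = x) /\ (forall x, exists a, fac__B p a = x).

Definition full_right_integral (psi : {scalar A}) : Prop :=
  right_integral psi /\
  exists2 p, adapted psi p &
    (forall y, exists a, fac_C_ p a = y) /\ (forall y, exists a, fac__C p a = y).

End Integrals.
End HopfAlgebroids.

(* Main.v *)
Require Import Defs.
From HB Require Import structures.
From mathcomp Require Import all_boot all_order all_algebra.
From mathcomp Require Import boolp reals complex.
Set Implicit Arguments.
Unset Strict Implicit.
Unset Printing Implicit Defensive.
Import GRing.Theory.
Local Open Scope ring_scope.

(** Apply the invariance of psi to Delta_B(r)(1 (x) s) and that of phi to
    Delta_B(p)(q (x) 1): both kinds of elements span A (x)_l A, so comparing the
    two yields for every a an element r(a) with psi(x a) = phi(x r(a)) for all x.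
    This r must be right multiplication by delta_psi.

    Left multiplication by delta_psi needs the antipode S.  It is obtained from
    the map c (x) a |-> c S(a), which sends (u (x) 1)Delta_C(v) to
    u S_B(epsB(v)), and it satisfies the strong invariance relations
      S(x_(1) phi(x_(2) b)) = b_(1) phi(x b_(2)),
      S(psi(b x_(1)) x_(2)) = psi(b_(1) x) b_(2).
    Then phi o S is a right integral, S is injective by the first step for
    phi o S, and the two relations combine to
      psi(c_(1) phi(S^-1(c_(2)) b) x) = phi(x psi(c S^-1(b_(1))) b_(2)).
    Hence for every u there is an a' with psi(u x) = phi(x a') for all x.  For
    psi = phi o S this shows that every functional phi(- c) is some phi(u -);
    in general, if phi(u x) = phi(x c) for all x, then a' = delta_psi c.

    The tensor product A (x)_l A may be degenerate: it may contain t != 0 with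
    t(b (x) c) = 0 for all b, c.  Identities in it and in A (x)_r A are
    therefore used only after contracting one leg by a functional, which kills
    such t because phi is faithful. *)

(** * Balanced maps out of quotients of tensor products *)

Section TensorTheory.
Local Open Scope quotient_scope.
Variables (K : fieldType) (M N : lmodType K) (I : Type).
Variables (f : I -> M -> M) (g : I -> N -> N).

Lemma balanced_tensor : balanced f g (tensor f g).
Proof.
split=> [m m' n|m n n'|k m n|k m n|i m n]; rewrite /tensor.
- by rewrite (tens_eq (tensor_eq_Dl _ _ _ _ _)) [RHS]tensD_pi.
- by rewrite (tens_eq (tensor_eq_Dr _ _ _ _ _)) [RHS]tensD_pi.
- by rewrite [RHS]tensZ_pi.
- by rewrite -(tens_eq (tensor_eq_Z _ _ _ _ _)) [RHS]tensZ_pi.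
- by apply: tens_eq; have := tensor_eq_bal f g 1 i m n; rewrite !scale1r.
Qed.

Lemma tens_ind (P : tens f g -> Prop) :
  P 0 -> (forall t t', P t -> P t' -> P (t + t')) ->
  (forall m n, P (tensor f g m n)) -> forall t, P t.
Proof.
move=> P0 PD Pt; elim/tensW; elim=> [//|[m n] s ih].
rewrite (_ : \pi_(tens f g) ((m, n) :: s) = tensor f g m n + \pi_(tens f g) s).
  exact: PD.
by rewrite [RHS]tensD_pi.
Qed.

(** [tmap beta] is linear only for balanced [beta]; carrying the proof as an argument lets the
    linear structure be inferred. *)
Definition tlift (V : lmodType K) (beta : M -> N -> V) (h : balanced f g beta) :
  tens f g -> V := tmap beta.
HB.instance Definition _ (V : lmodType K) (beta : M -> N -> V)
  (h : balanced f g beta) :=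
  GRing.isLinear.Build K (tens f g) V *:%R (tlift h) (tmap_linear h).

Lemma tliftE (V : lmodType K) (beta : M -> N -> V) (h : balanced f g beta) m n :
  tlift h (tensor f g m n) = beta m n.
Proof. exact: tmap_tensor. Qed.

End TensorTheory.

Lemma linear_mapE (K : fieldType) (U V : lmodType K) (F : U -> V) :
  linear F -> F 0 = 0 /\ {morph F : a b / a + b}.
Proof.
move=> Fl; have FD : {morph F : a b / a + b}.
  by move=> a b; have := Fl 1 a b; rewrite !scale1r.
by split=> //; apply: (addrI (F 0)); rewrite -FD !addr0.
Qed.

Lemma linear_mapZ (K : fieldType) (U V : lmodType K) (F : U -> V) :
  linear F -> forall k a, F (k *: a) = k *: F a.
Proof.
move=> Fl k a; have [F0 _] := linear_mapE Fl.
by have := Fl k a 0; rewrite F0 !addr0.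
Qed.

(** * Multipliers of a non-degenerate algebra *)

Section MultiplierTheory.
Variables (K : fieldType) (A : nuAlgType K).
Implicit Types (x y : multiplier A) (a b c : A).

HB.instance Definition _ x := GRing.isLinear.Build K A A *:%R (lmult x)
  (lmult_linear (multiplierP x)).
HB.instance Definition _ x := GRing.isLinear.Build K A A *:%R (rmult x)
  (rmult_linear (multiplierP x)).
Fact numul_is_linear a : linear (numul a).
Proof. by move=> k b c; rewrite numulDr numulZr. Qed.
HB.instance Definition _ a := GRing.isLinear.Build K A A *:%R (numul a)
  (numul_is_linear a).

Lemma lmA x a b : x *> (a ** b) = (x *> a) ** b.
Proof. exact: lmult_mul (multiplierP x) a b. Qed.
Lemma rmA x a b : (a ** b) <* x = a ** (b <* x).
Proof. exact: rmult_mul (multiplierP x) a b. Qed.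
Lemma lrA x a b : a ** (x *> b) = (a <* x) ** b.
Proof. exact: lrmult (multiplierP x) a b. Qed.

Lemma laD x y a : (x + y) *> a = x *> a + y *> a. Proof. by []. Qed.
Lemma laZ k x a : (k *: x) *> a = k *: (x *> a). Proof. by []. Qed.
Lemma laN x a : (- x) *> a = - (x *> a). Proof. by []. Qed.
Lemma laM x y a : (x * y) *> a = x *> (y *> a). Proof. by []. Qed.
Lemma raD x y a : a <* (x + y) = a <* x + a <* y. Proof. by []. Qed.
Lemma raZ k x a : a <* (k *: x) = k *: (a <* x). Proof. by []. Qed.
Lemma raM x y a : a <* (x * y) = (a <* x) <* y. Proof. by []. Qed.
Lemma la0 a : 0 *> a = 0. Proof. by []. Qed.
Lemma ra0 a : a <* 0 = 0. Proof. by []. Qed.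

Lemma numul_suml (J : Type) (s : seq J) (F : J -> A) b :
  (\sum_(i <- s) F i) ** b = \sum_(i <- s) F i ** b.
Proof.
by apply: (big_morph (fun a => a ** b)) => [a c|]; rewrite ?numulDl ?numul0a.
Qed.

Hypothesis nondegA : Defs.nondegenerate A.

Lemma numul_injl a : (forall b, a ** b = 0) -> a = 0.
Proof.
move=> h; apply/eqP; apply: contraT => /nondegA[[b +] _].
by rewrite h eqxx.
Qed.
Lemma numul_injr a : (forall b, b ** a = 0) -> a = 0.
Proof.
move=> h; apply/eqP; apply: contraT => /nondegA[_ [b +]].
by rewrite h eqxx.
Qed.
Lemma numul_eql a b : (forall c, a ** c = b ** c) -> a = b.
Proof.
move=> h; apply/eqP; rewrite -subr_eq0; apply/eqP/numul_injl => c.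
by rewrite numulDl numulNl h subrr.
Qed.
Lemma numul_eqr a b : (forall c, c ** a = c ** b) -> a = b.
Proof.
move=> h; apply/eqP; rewrite -subr_eq0; apply/eqP/numul_injr => c.
by rewrite linearB /= h subrr.
Qed.

Lemma lrC x y a : (x *> a) <* y = x *> (a <* y).
Proof. by apply: numul_eqr => c; rewrite -rmA !lrA rmA. Qed.

Lemma multiplier_eq_l x y : (forall a, x *> a = y *> a) -> x = y.
Proof.
move=> h; apply: multiplier_eq => // a; apply: numul_eql => b.
by rewrite -!lrA h.
Qed.
Lemma multiplier_eq_r x y : (forall a, a <* x = a <* y) -> x = y.
Proof.
move=> h; apply: multiplier_eq => // a; apply: numul_eqr => b.
by rewrite !lrA h.
Qed.

(** Each identity required of a multiplier can be tested after multiplication on the other side,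
    where the relation trades [l] for [r]; non-degeneracy then removes the test element. *)
Lemma is_multiplier_lr (l r : A -> A) :
  (forall a b, a ** l b = r a ** b) -> is_multiplier l r.
Proof.
move=> lr; split=> // [k a b|k a b|a b|a b].
- by apply: numul_eqr => c; rewrite linearP /= !lr linearP.
- by apply: numul_eql => c; rewrite numulDl numulZl -!lr numulDl numulZl.
- by apply: numul_eqr => c; rewrite lr !numulA lr.
- by apply: numul_eql => c; rewrite -lr -!numulA lr.
Qed.

End MultiplierTheory.

(** * Faithful functionals *)

Section FaithfulFunctionals.
Variables (K : fieldType) (A : nuAlgType K) (w : {scalar A}).
Hypothesis w_faithful : faithful w.

Lemma faithful_injl a : (forall b, w (a ** b) = 0) -> a = 0.
Proof.
move=> h; apply/eqP; apply: contraT => /w_faithful[[b +] _].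
by rewrite h eqxx.
Qed.
Lemma faithful_injr a : (forall b, w (b ** a) = 0) -> a = 0.
Proof.
move=> h; apply/eqP; apply: contraT => /w_faithful[_ [b +]].
by rewrite h eqxx.
Qed.
Lemma faithful_eql a b : (forall c, w (a ** c) = w (b ** c)) -> a = b.
Proof.
move=> h; apply/eqP; rewrite -subr_eq0; apply/eqP/faithful_injl => c.
by rewrite numulDl numulNl linearB /= h subrr.
Qed.
Lemma faithful_eqr a b : (forall c, w (c ** a) = w (c ** b)) -> a = b.
Proof.
move=> h; apply/eqP; rewrite -subr_eq0; apply/eqP/faithful_injr => c.
by rewrite numulDr numulNr linearB /= h subrr.
Qed.

End FaithfulFunctionals.

Lemma tmap_lin (K : fieldType) (M N V W : lmodType K) (I : Type)
    (f : I -> M -> M) (g : I -> N -> N) (G : V -> W) (beta : M -> N -> V)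
    (t : tens f g) : linear G -> G (tmap beta t) = tmap (fun m n => G (beta m n)) t.
Proof. by move=> /linear_mapE[G0 GD]; rewrite /tmap (big_morph G GD G0). Qed.

Lemma tmap_ext (K : fieldType) (M N V : lmodType K) (I : Type)
    (f : I -> M -> M) (g : I -> N -> N) (beta gamma : M -> N -> V)
    (t : tens f g) : beta =2 gamma -> tmap beta t = tmap gamma t.
Proof. by move=> e; apply: eq_bigr => p _; apply: e. Qed.

Ltac bilinear := by rewrite ?(linearD, linearZ_LR, numulDl, numulDr, numulZl,
  numulZr, laD, laZ, raD, raZ) /=.

(** Covers the module maps from A to B or C on either side: [act] and [mul] fix the base algebra and
    the side. Equivariance is what makes contractions of balanced tensors well defined. *)
Record equimap (K : fieldType) (A : lmodType K) (V : nuAlgType K)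
    (act : V -> A -> A) (mul : V -> V -> V) := Equimap {
  eqm :> A -> V;
  eqm_linear : linear eqm;
  eqmE : forall v a, eqm (act v a) = mul v (eqm a)
}.
HB.instance Definition _ (K : fieldType) (A : lmodType K) (V : nuAlgType K)
  (act : V -> A -> A) (mul : V -> V -> V) (F : equimap act mul) :=
  GRing.isLinear.Build K A V *:%R (eqm F) (eqm_linear F).

(** * Quantum graphs and equivariant maps into the base algebras *)

Section QuantumGraphs.
Variables (K : fieldType) (Q : quantum_graphs K).
Local Notation A := (qgA Q).
Local Notation B := (qgB Q).
Local Notation C := (qgC Q).
Local Notation iB := (@iB K Q).
Local Notation iC := (@iC K Q).
Local Notation SB := (@SB K Q).
Local Notation SC := (@SC K Q).
Local Notation SB' := (@SBinv K Q).
Local Notation SC' := (@SCinv K Q).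
Local Notation ndA := (@qg_nondegenerate K Q).
Local Notation el_l := (@el_l K Q).
Local Notation el_r := (@el_r K Q).
Local Notation tens_l := (tens_l Q).
Local Notation tens_r := (tens_r Q).

Fact SBinv_linear : linear SB'.
Proof. exact: can2_linear (@SBK K Q) (@SBinvK K Q). Qed.
HB.instance Definition _ := GRing.isLinear.Build K C B *:%R SB' SBinv_linear.
Fact SCinv_linear : linear SC'.
Proof. exact: can2_linear (@SCK K Q) (@SCinvK K Q). Qed.
HB.instance Definition _ := GRing.isLinear.Build K B C *:%R SC' SCinv_linear.

Lemma SB'_anti y y' : SB' (y ** y') = SB' y' ** SB' y.
Proof. by apply: (can_inj (@SBK K Q)); rewrite SB_anti !SBinvK. Qed.
Lemma SC'_anti x x' : SC' (x ** x') = SC' x' ** SC' x.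
Proof. by apply: (can_inj (@SCK K Q)); rewrite SC_anti !SCinvK. Qed.

Lemma lBM x x' (a : A) : iB (x ** x') *> a = iB x *> (iB x' *> a).
Proof. by rewrite iBM. Qed.
Lemma rBM x x' (a : A) : a <* iB (x ** x') = a <* iB x <* iB x'.
Proof. by rewrite iBM. Qed.
Lemma lCM y y' (a : A) : iC (y ** y') *> a = iC y *> (iC y' *> a).
Proof. by rewrite iCM. Qed.
Lemma rCM y y' (a : A) : a <* iC (y ** y') = a <* iC y <* iC y'.
Proof. by rewrite iCM. Qed.
Lemma lBC x y (a : A) : iB x *> (iC y *> a) = iC y *> (iB x *> a).
Proof. by rewrite -!laM iBC_comm. Qed.
Lemma rBC x y (a : A) : a <* iB x <* iC y = a <* iC y <* iB x.
Proof. by rewrite -!raM iBC_comm. Qed.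
Lemma lrq (m m' : multiplier A) (a : A) : (m *> a) <* m' = m *> (a <* m').
Proof. exact: lrC ndA _ _ _. Qed.

Lemma lB_inj x x' : (forall a : A, iB x *> a = iB x' *> a) -> x = x'.
Proof. by move=> h; apply: (@iB_inj K Q); apply: (multiplier_eq_l ndA). Qed.
Lemma lC_inj y y' : (forall a : A, iC y *> a = iC y' *> a) -> y = y'.
Proof. by move=> h; apply: (@iC_inj K Q); apply: (multiplier_eq_l ndA). Qed.
Lemma rB_inj x x' : (forall a : A, a <* iB x = a <* iB x') -> x = x'.
Proof. by move=> h; apply: (@iB_inj K Q); apply: (multiplier_eq_r ndA). Qed.
Lemma rC_inj y y' : (forall a : A, a <* iC y = a <* iC y') -> y = y'.
Proof. by move=> h; apply: (@iC_inj K Q); apply: (multiplier_eq_r ndA). Qed.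

Section Generation.
Variable P : A -> Prop.
Hypotheses (P0 : P 0) (PD : forall a b, P a -> P b -> P (a + b)).

Lemma big_ind_gen (J : Type) (s : seq J) (F : J -> A) :
  (forall i, P (F i)) -> P (\sum_(i <- s) F i).
Proof. by move=> PF; elim/big_ind: _. Qed.
Lemma lB_ind : (forall x a, P (iB x *> a)) -> forall a, P a.
Proof. by move=> h a; have [s ->] := qgBA a; apply: big_ind_gen. Qed.
Lemma rB_ind : (forall x a, P (a <* iB x)) -> forall a, P a.
Proof. by move=> h a; have [s ->] := qgAB a; apply: big_ind_gen. Qed.
Lemma lC_ind : (forall y a, P (iC y *> a)) -> forall a, P a.
Proof. by move=> h a; have [s ->] := qgCA a; apply: big_ind_gen. Qed.
Lemma rC_ind : (forall y a, P (a <* iC y)) -> forall a, P a.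
Proof. by move=> h a; have [s ->] := qgAC a; apply: big_ind_gen. Qed.
End Generation.

(* No single factor of [sandwich] can be dropped, B and C being non-unital. *)
Lemma sandwich_ind (P : A -> Prop) : P 0 ->
  (forall a b, P a -> P b -> P (a + b)) ->
  (forall x y a x' y', P (sandwich x y a x' y')) -> forall a, P a.
Proof.
move=> P0 PD Ps; apply: (rC_ind P0 PD) => y' a; move: a.
apply: (rB_ind (P := fun a => P (a <* iC y'))) => [|a b|x' a].
- by rewrite linear0.
- by rewrite linearD; apply: PD.
move: a; apply: (lB_ind (P := fun a => P (a <* iB x' <* iC y'))) => [|a b|x a].
- by rewrite !linear0.
- by rewrite !linearD; apply: PD.
move: a; apply: (lC_ind (P := fun a => P ((iB x *> a) <* iB x' <* iC y')))
  => [|a b|y a].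
- by rewrite !linear0.
- by rewrite !linearD; apply: PD.
exact: Ps.
Qed.

Definition lBmap := equimap (@lB K Q) (fun x x' => x ** x').
Definition rBmap := equimap (@rB K Q) (fun x x' => x' ** x).
Definition lCmap := equimap (@lC K Q) (fun y y' => y ** y').
Definition rCmap := equimap (@rC K Q) (fun y y' => y' ** y).

Lemma lBmapE (F : lBmap) x a : F (iB x *> a) = x ** F a.
Proof. exact: eqmE F x a. Qed.
Lemma rBmapE (F : rBmap) x a : F (a <* iB x) = F a ** x.
Proof. exact: eqmE F x a. Qed.
Lemma lCmapE (F : lCmap) y a : F (iC y *> a) = y ** F a.
Proof. exact: eqmE F y a. Qed.
Lemma rCmapE (F : rCmap) y a : F (a <* iC y) = F a ** y.
Proof. exact: eqmE F y a. Qed.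

Fact lBmap_mul_lin (F : lBmap) c : linear (fun a => F (a ** c)).
Proof. by move=> k a b; rewrite numulDl numulZl linearP. Qed.
Fact lBmap_mulE (F : lBmap) c x a : F (lB x a ** c) = x ** F (a ** c).
Proof. by rewrite -lmA lBmapE. Qed.
Definition lBmap_mul F c : lBmap := Equimap (lBmap_mul_lin F c) (lBmap_mulE F c).
Fact lCmap_mul_lin (F : lCmap) c : linear (fun a => F (a ** c)).
Proof. by move=> k a b; rewrite numulDl numulZl linearP. Qed.
Fact lCmap_mulE (F : lCmap) c x a : F (lC x a ** c) = x ** F (a ** c).
Proof. by rewrite -lmA lCmapE. Qed.
Definition lCmap_mul F c : lCmap := Equimap (lCmap_mul_lin F c) (lCmap_mulE F c).
Fact rBmap_mul_lin (F : rBmap) c : linear (fun a => F (c ** a)).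
Proof. by move=> k a b; rewrite !linearP. Qed.
Fact rBmap_mulE (F : rBmap) c x a : F (c ** rB x a) = F (c ** a) ** x.
Proof. by rewrite -rmA rBmapE. Qed.
Definition rBmap_mul F c : rBmap := Equimap (rBmap_mul_lin F c) (rBmap_mulE F c).
Fact rCmap_mul_lin (F : rCmap) c : linear (fun a => F (c ** a)).
Proof. by move=> k a b; rewrite !linearP. Qed.
Fact rCmap_mulE (F : rCmap) c x a : F (c ** rC x a) = F (c ** a) ** x.
Proof. by rewrite -rmA rCmapE. Qed.
Definition rCmap_mul F c : rCmap := Equimap (rCmap_mul_lin F c) (rCmap_mulE F c).

Lemma el_lDl a a' b : el_l (a + a') b = el_l a b + el_l a' b.
Proof. exact: balanced_Dl (balanced_tensor _ _) _ _ _. Qed.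
Lemma el_lDr a b b' : el_l a (b + b') = el_l a b + el_l a b'.
Proof. exact: balanced_Dr (balanced_tensor _ _) _ _ _. Qed.
Lemma el_lZl k a b : el_l (k *: a) b = k *: el_l a b.
Proof. exact: balanced_Zl (balanced_tensor _ _) _ _ _. Qed.
Lemma el_lZr k a b : el_l a (k *: b) = k *: el_l a b.
Proof. exact: balanced_Zr (balanced_tensor _ _) _ _ _. Qed.
Lemma el_l_bal x a b : el_l (iB x *> a) b = el_l a (iC (SB x) *> b).
Proof. exact: balanced_bal (balanced_tensor _ _) _ _ _. Qed.
Lemma el_rDl a a' b : el_r (a + a') b = el_r a b + el_r a' b.
Proof. exact: balanced_Dl (balanced_tensor _ _) _ _ _. Qed.
Lemma el_rDr a b b' : el_r a (b + b') = el_r a b + el_r a b'.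
Proof. exact: balanced_Dr (balanced_tensor _ _) _ _ _. Qed.
Lemma el_rZl k a b : el_r (k *: a) b = k *: el_r a b.
Proof. exact: balanced_Zl (balanced_tensor _ _) _ _ _. Qed.
Lemma el_rZr k a b : el_r a (k *: b) = k *: el_r a b.
Proof. exact: balanced_Zr (balanced_tensor _ _) _ _ _. Qed.
Lemma el_r_bal y a b : el_r (a <* iB (SC y)) b = el_r a (b <* iC y).
Proof. exact: balanced_bal (balanced_tensor _ _) _ _ _. Qed.

Lemma tens_l_ind (P : tens_l -> Prop) : P 0 ->
  (forall t t', P t -> P t' -> P (t + t')) ->
  (forall a b, P (el_l a b)) -> forall t, P t.
Proof. exact: tens_ind. Qed.
Lemma tens_r_ind (P : tens_r -> Prop) : P 0 ->
  (forall t t', P t -> P t' -> P (t + t')) ->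
  (forall a b, P (el_r a b)) -> forall t, P t.
Proof. exact: tens_ind. Qed.

Lemma el_l_act_balanced (u v : A -> A) : linear u -> linear v ->
  (forall x a, u (iB x *> a) = iB x *> u a) ->
  (forall y a, v (iC y *> a) = iC y *> v a) ->
  balanced (@lB K Q) (@lSB K Q) (fun a b => el_l (u a) (v b)).
Proof.
move=> ul vl uB vC.
have [_ uD uZ] := mult_linE ul; have [_ vD vZ] := mult_linE vl.
split=> *; rewrite ?uD ?uZ ?vD ?vZ ?el_lDl ?el_lDr ?el_lZl ?el_lZr //.
by rewrite /lB /lSB uB vC el_l_bal.
Qed.

Lemma el_r_act_balanced (u v : A -> A) : linear u -> linear v ->
  (forall x a, u (a <* iB x) = u a <* iB x) ->
  (forall y a, v (a <* iC y) = v a <* iC y) ->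
  balanced (@rSC K Q) (@rC K Q) (fun a b => el_r (u a) (v b)).
Proof.
move=> ul vl uB vC.
have [_ uD uZ] := mult_linE ul; have [_ vD vZ] := mult_linE vl.
split=> *; rewrite ?uD ?uZ ?vD ?vZ ?el_rDl ?el_rDr ?el_rZl ?el_rZr //.
by rewrite /rSC /rC uB vC el_r_bal.
Qed.

Fact numulr_linear (b : A) : linear (fun a => a ** b).
Proof. by move=> k a c; rewrite numulDl numulZl. Qed.
Fact id_linear : linear (fun a : A => a).
Proof. by []. Qed.

(** * Contractions to A *)

Fact fctr_balanced (F : lCmap) : balanced (@lB K Q) (@lSB K Q)
  (fun d e => iB (SB' (F e)) *> d).
Proof.
split=> [*|*|*|*|x d e]; try by bilinear.
by rewrite /lB /lSB lCmapE SB'_anti SBK lBM.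
Qed.
(** [fctr] and [kctr] contract the second leg of A (x)_l A and of A (x)_r A, [gctr] and [hctr] the
    first. The anti-isomorphisms carry the value of [F] into the base algebra that acts on the
    remaining leg. *)
Definition fctr F : tens_l -> A := tlift (fctr_balanced F).
HB.instance Definition _ F := GRing.Linear.copy (fctr F) (tlift (fctr_balanced F)).
Lemma fctrE F d e : fctr F (el_l d e) = iB (SB' (F e)) *> d.
Proof. exact: tliftE. Qed.

Fact gctr_balanced (F : lBmap) : balanced (@lB K Q) (@lSB K Q)
  (fun d e => iC (SB (F d)) *> e).
Proof.
split=> [*|*|*|*|x d e]; try by bilinear.
by rewrite /lB /lSB lBmapE SB_anti lCM.
Qed.
Definition gctr F : tens_l -> A := tlift (gctr_balanced F).
HB.instance Definition _ F := GRing.Linear.copy (gctr F) (tlift (gctr_balanced F)).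
Lemma gctrE F d e : gctr F (el_l d e) = iC (SB (F d)) *> e.
Proof. exact: tliftE. Qed.

Fact kctr_balanced (F : rCmap) : balanced (@rSC K Q) (@rC K Q)
  (fun d e => d <* iB (SC (F e))).
Proof.
split=> [*|*|*|*|x d e]; try by bilinear.
by rewrite /rSC /rC rCmapE SC_anti rBM.
Qed.
Definition kctr F : tens_r -> A := tlift (kctr_balanced F).
HB.instance Definition _ F := GRing.Linear.copy (kctr F) (tlift (kctr_balanced F)).
Lemma kctrE F d e : kctr F (el_r d e) = d <* iB (SC (F e)).
Proof. exact: tliftE. Qed.

Fact hctr_balanced (F : rBmap) : balanced (@rSC K Q) (@rC K Q)
  (fun d e => e <* iC (SC' (F d))).
Proof.
split=> [*|*|*|*|x d e]; try by bilinear.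
by rewrite /rSC /rC rBmapE SC'_anti SCK rCM.
Qed.
Definition hctr F : tens_r -> A := tlift (hctr_balanced F).
HB.instance Definition _ F := GRing.Linear.copy (hctr F) (tlift (hctr_balanced F)).
Lemma hctrE F d e : hctr F (el_r d e) = e <* iC (SC' (F d)).
Proof. exact: tliftE. Qed.

Fact mulL_balanced (b c : A) : balanced (@lB K Q) (@lSB K Q)
  (fun d e => el_l (d ** b) (e ** c)).
Proof.
by apply: el_l_act_balanced => *;
  [exact: numulr_linear | exact: numulr_linear | rewrite lmA | rewrite lmA].
Qed.
Definition mulL b c : tens_l -> tens_l := tlift (mulL_balanced b c).
HB.instance Definition _ b c :=
  GRing.Linear.copy (mulL b c) (tlift (mulL_balanced b c)).
Lemma mulLE b c d e : mulL b c (el_l d e) = el_l (d ** b) (e ** c).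
Proof. exact: tliftE. Qed.

Fact mulR_balanced (a b : A) : balanced (@rSC K Q) (@rC K Q)
  (fun d e => el_r (a ** d) (b ** e)).
Proof.
by apply: el_r_act_balanced => *;
  [exact: numul_is_linear | exact: numul_is_linear | rewrite rmA | rewrite rmA].
Qed.
Definition mulR a b : tens_r -> tens_r := tlift (mulR_balanced a b).
HB.instance Definition _ a b :=
  GRing.Linear.copy (mulR a b) (tlift (mulR_balanced a b)).
Lemma mulRE a b d e : mulR a b (el_r d e) = el_r (a ** d) (b ** e).
Proof. exact: tliftE. Qed.

(* Equality up to the degeneracy of the tensor products. *)
Definition eqL (t t' : tens_l) := forall b c, mulL b c t = mulL b c t'.
Definition eqR (t t' : tens_r) := forall a b, mulR a b t = mulR a b t'.

Lemma fctr_mul F b c t : fctr F (mulL b c t) = fctr (lCmap_mul F c) t ** b.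
Proof.
elim/tens_l_ind: t => [|t t' ht ht'|d e]; rewrite ?linear0 ?numul0a //.
  by rewrite !linearD /= numulDl ht ht'.
by rewrite mulLE !fctrE lmA.
Qed.
Lemma gctr_mul F b c t : gctr F (mulL b c t) = gctr (lBmap_mul F b) t ** c.
Proof.
elim/tens_l_ind: t => [|t t' ht ht'|d e]; rewrite ?linear0 ?numul0a //.
  by rewrite !linearD /= numulDl ht ht'.
by rewrite mulLE !gctrE lmA.
Qed.
Lemma kctr_mul F a b t : kctr F (mulR a b t) = a ** kctr (rCmap_mul F b) t.
Proof.
elim/tens_r_ind: t => [|t t' ht ht'|d e]; rewrite ?linear0 //.
  by rewrite !linearD /= ht ht'.
by rewrite mulRE !kctrE rmA.
Qed.
Lemma hctr_mul F a b t : hctr F (mulR a b t) = b ** hctr (rBmap_mul F a) t.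
Proof.
elim/tens_r_ind: t => [|t t' ht ht'|d e]; rewrite ?linear0 //.
  by rewrite !linearD /= ht ht'.
by rewrite mulRE !hctrE rmA.
Qed.

(** * Adapted functionals and contractions *)

Section Adapted.
Variables (muB : {scalar B}) (muC : {scalar C}).
Hypotheses (muB_faithful : faithful muB) (muC_faithful : faithful muC).
Hypotheses (mu_SC : forall y, muB (SC y) = muC y).
Hypotheses (mu_SB : forall x, muC (SB x) = muB x).

(* [Bl w], [Br w], [Cl w] and [Cr w] below are the factors usually written
   _B w, w_B, _C w and w_C. *)
Record adfun := Adfun {
  adw :> {scalar A};
  adp : factors Q;
  adP : adapted muB muC adw adp
}.
Implicit Types w : adfun.

Fact Bl_linear w : linear (fac_B_ (adp w)).
Proof.
move=> k a b; apply: (faithful_eqr muB_faithful) => x.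
rewrite numulDr numulZr !linearP /= -!(adapted_B_ (adP w)).
by rewrite !linearP.
Qed.
Fact BlE w x a : fac_B_ (adp w) (lB x a) = x ** fac_B_ (adp w) a.
Proof.
apply: (faithful_eqr muB_faithful) => x'.
by rewrite numulA -!(adapted_B_ (adP w)) lBM.
Qed.
Definition Bl w : lBmap := Equimap (Bl_linear w) (BlE w).
Fact Br_linear w : linear (fac__B (adp w)).
Proof.
move=> k a b; apply: (faithful_eql muB_faithful) => x.
rewrite numulDl numulZl !linearP /= -!(adapted__B (adP w)).
by rewrite !linearP.
Qed.
Fact BrE w x a : fac__B (adp w) (rB x a) = fac__B (adp w) a ** x.
Proof.
apply: (faithful_eql muB_faithful) => x'.
by rewrite -numulA -!(adapted__B (adP w)) rBM.
Qed.
Definition Br w : rBmap := Equimap (Br_linear w) (BrE w).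
Fact Cl_linear w : linear (fac_C_ (adp w)).
Proof.
move=> k a b; apply: (faithful_eqr muC_faithful) => x.
rewrite numulDr numulZr !linearP /= -!(adapted_C_ (adP w)).
by rewrite !linearP.
Qed.
Fact ClE w x a : fac_C_ (adp w) (lC x a) = x ** fac_C_ (adp w) a.
Proof.
apply: (faithful_eqr muC_faithful) => x'.
by rewrite numulA -!(adapted_C_ (adP w)) lCM.
Qed.
Definition Cl w : lCmap := Equimap (Cl_linear w) (ClE w).
Fact Cr_linear w : linear (fac__C (adp w)).
Proof.
move=> k a b; apply: (faithful_eql muC_faithful) => x.
rewrite numulDl numulZl !linearP /= -!(adapted__C (adP w)).
by rewrite !linearP.
Qed.
Fact CrE w x a : fac__C (adp w) (rC x a) = fac__C (adp w) a ** x.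
Proof.
apply: (faithful_eql muC_faithful) => x'.
by rewrite -numulA -!(adapted__C (adP w)) rCM.
Qed.
Definition Cr w : rCmap := Equimap (Cr_linear w) (CrE w).

Lemma adBl w x a : w (iB x *> a) = muB (x ** Bl w a).
Proof. exact: adapted_B_ (adP w) x a. Qed.
Lemma adBr w x a : w (a <* iB x) = muB (Br w a ** x).
Proof. exact: adapted__B (adP w) x a. Qed.
Lemma adCl w y a : w (iC y *> a) = muC (y ** Cl w a).
Proof. exact: adapted_C_ (adP w) y a. Qed.
Lemma adCr w y a : w (a <* iC y) = muC (Cr w a ** y).
Proof. exact: adapted__C (adP w) y a. Qed.

Lemma muC_SBl x y : muC (SB x ** y) = muB (SB' y ** x).
Proof. by rewrite -{1}(SBinvK y) -SB_anti mu_SB. Qed.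
Lemma muC_SBr x y : muC (y ** SB x) = muB (x ** SB' y).
Proof. by rewrite -{1}(SBinvK y) -SB_anti mu_SB. Qed.
Lemma muB_SCl x y : muB (SC y ** x) = muC (SC' x ** y).
Proof. by rewrite -{1}(SCinvK x) -SC_anti mu_SC. Qed.
Lemma muB_SCr x y : muB (x ** SC y) = muC (y ** SC' x).
Proof. by rewrite -{1}(SCinvK x) -SC_anti mu_SC. Qed.

(** A Fubini rule: contracting both legs gives the same scalar in either order, because the base
    weight is compatible with S_B. The next three are its variants. *)
Lemma ad_fctr w (F : lCmap) t : w (fctr F t) = muC (F (gctr (Bl w) t)).
Proof.
elim/tens_l_ind: t => [|t t' ht ht'|d e]; rewrite ?linear0 //.
  by rewrite !linearD /= ht ht'.
by rewrite fctrE gctrE adBl lCmapE muC_SBl.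
Qed.
Lemma ad_gctr w (F : lBmap) t : w (gctr F t) = muB (F (fctr (Cl w) t)).
Proof.
elim/tens_l_ind: t => [|t t' ht ht'|d e]; rewrite ?linear0 //.
  by rewrite !linearD /= ht ht'.
by rewrite fctrE gctrE adCl lBmapE muC_SBl.
Qed.
Lemma ad_kctr w (F : rCmap) t : w (kctr F t) = muC (F (hctr (Br w) t)).
Proof.
elim/tens_r_ind: t => [|t t' ht ht'|d e]; rewrite ?linear0 //.
  by rewrite !linearD /= ht ht'.
by rewrite kctrE hctrE adBr rCmapE muB_SCr.
Qed.
Lemma ad_hctr w (F : rBmap) t : w (hctr F t) = muB (F (kctr (Cr w) t)).
Proof.
elim/tens_r_ind: t => [|t t' ht ht'|d e]; rewrite ?linear0 //.
  by rewrite !linearD /= ht ht'.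
by rewrite kctrE hctrE adCr rBmapE muB_SCr.
Qed.

Variable phi : adfun.
Hypothesis phi_faithful : faithful phi.

Lemma phi_eql (a b : A) : (forall c, phi (a ** c) = phi (b ** c)) -> a = b.
Proof. exact: faithful_eql. Qed.
Lemma phi_eqr (a b : A) : (forall c, phi (c ** a) = phi (c ** b)) -> a = b.
Proof. exact: faithful_eqr. Qed.

(** By Fubini, phi([gctr F t] z) depends only on the contraction of the second leg by phi(- z). That
    one is visible after multiplication: applied to [mulL b z t], the contraction by phi returns it
    times b, and non-degeneracy removes b. *)
Lemma gctr_eqL (F : lBmap) t t' : eqL t t' -> gctr F t = gctr F t'.
Proof.
move=> h; apply: phi_eql => z; pose G c := lCmap_mul (Cl phi) c.
suff fE : forall c, fctr (G c) t = fctr (G c) t'.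
  have gE s : phi (gctr F s ** z) = muB (F (fctr (G z) s)).
    elim/tens_l_ind: s => [|s s' ht ht'|d e]; rewrite ?linear0 ?numul0a ?linear0 //.
      by rewrite !linearD /= numulDl linearD /= ht ht'.
    by rewrite fctrE gctrE -lmA adCl lBmapE muC_SBl.
  by rewrite !gE fE.
by move=> c; apply: (numul_eql ndA) => b; rewrite -!fctr_mul h.
Qed.
Lemma fctr_eqL (F : lCmap) t t' : eqL t t' -> fctr F t = fctr F t'.
Proof.
move=> h; apply: phi_eql => z; pose G c := lBmap_mul (Bl phi) c.
suff gE : forall c, gctr (G c) t = gctr (G c) t'.
  have fE s : phi (fctr F s ** z) = muC (F (gctr (G z) s)).
    elim/tens_l_ind: s => [|s s' ht ht'|d e]; rewrite ?linear0 ?numul0a ?linear0 //.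
      by rewrite !linearD /= numulDl linearD /= ht ht'.
    by rewrite fctrE gctrE -lmA adBl lCmapE muC_SBl.
  by rewrite !fE gE.
by move=> b; apply: (numul_eql ndA) => c; rewrite -!gctr_mul h.
Qed.
Lemma kctr_eqR (F : rCmap) t t' : eqR t t' -> kctr F t = kctr F t'.
Proof.
move=> h; apply: phi_eqr => z; pose G c := rBmap_mul (Br phi) c.
suff hE : forall c, hctr (G c) t = hctr (G c) t'.
  have kE s : phi (z ** kctr F s) = muC (F (hctr (G z) s)).
    elim/tens_r_ind: s => [|s s' ht ht'|d e]; rewrite ?linear0 //.
      by rewrite !linearD /= ht ht'.
    by rewrite kctrE hctrE -rmA adBr rCmapE muB_SCr.
  by rewrite !kE hE.
by move=> a; apply: (numul_eqr ndA) => b; rewrite -!hctr_mul h.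
Qed.
Lemma hctr_eqR (F : rBmap) t t' : eqR t t' -> hctr F t = hctr F t'.
Proof.
move=> h; apply: phi_eqr => z; pose G c := rCmap_mul (Cr phi) c.
suff kE : forall c, kctr (G c) t = kctr (G c) t'.
  have hE s : phi (z ** hctr F s) = muB (F (kctr (G z) s)).
    elim/tens_r_ind: s => [|s s' ht ht'|d e]; rewrite ?linear0 //.
      by rewrite !linearD /= ht ht'.
    by rewrite kctrE hctrE -rmA adCr rBmapE muB_SCr.
  by rewrite !hE kE.
by move=> b; apply: (numul_eqr ndA) => a; rewrite -!kctr_mul h.
Qed.

End Adapted.

(** * Multiplications and base actions on single legs *)

Ltac act_balanced := move=> *;
  first [apply: el_l_act_balanced | apply: el_r_act_balanced] => *;
  first [exact: numulr_linear | exact: numul_is_linear | exact: id_linear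
        | exact: linearP | by rewrite /= ?lmA ?rmA | exact: lBC | exact: rBC
        | exact: lrq | exact/esym/lrq | exact/esym/lBC | exact/esym/rBC].

Fact mulL1_balanced b : balanced (@lB K Q) (@lSB K Q)
  (fun d e => el_l (d ** b) e).
Proof. act_balanced. Qed.
Definition mulL1 b : tens_l -> tens_l := tlift (mulL1_balanced b).
HB.instance Definition _ b :=
  GRing.Linear.copy (mulL1 b) (tlift (mulL1_balanced b)).
Lemma mulL1E b d e : mulL1 b (el_l d e) = el_l (d ** b) e.
Proof. exact: tliftE. Qed.

Fact mulL2_balanced c : balanced (@lB K Q) (@lSB K Q)
  (fun d e => el_l d (e ** c)).
Proof. act_balanced. Qed.
Definition mulL2 c : tens_l -> tens_l := tlift (mulL2_balanced c).
HB.instance Definition _ c :=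
  GRing.Linear.copy (mulL2 c) (tlift (mulL2_balanced c)).
Lemma mulL2E c d e : mulL2 c (el_l d e) = el_l d (e ** c).
Proof. exact: tliftE. Qed.

Fact mulR1_balanced a : balanced (@rSC K Q) (@rC K Q)
  (fun d e => el_r (a ** d) e).
Proof. act_balanced. Qed.
Definition mulR1 a : tens_r -> tens_r := tlift (mulR1_balanced a).
HB.instance Definition _ a :=
  GRing.Linear.copy (mulR1 a) (tlift (mulR1_balanced a)).
Lemma mulR1E a d e : mulR1 a (el_r d e) = el_r (a ** d) e.
Proof. exact: tliftE. Qed.

Fact mulR2_balanced b : balanced (@rSC K Q) (@rC K Q)
  (fun d e => el_r d (b ** e)).
Proof. act_balanced. Qed.
Definition mulR2 b : tens_r -> tens_r := tlift (mulR2_balanced b).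
HB.instance Definition _ b :=
  GRing.Linear.copy (mulR2 b) (tlift (mulR2_balanced b)).
Lemma mulR2E b d e : mulR2 b (el_r d e) = el_r d (b ** e).
Proof. exact: tliftE. Qed.

Fact lactB_balanced x : balanced (@lB K Q) (@lSB K Q)
  (fun d e => el_l d (iB x *> e)).
Proof. act_balanced. Qed.
Definition lactB x : tens_l -> tens_l := tlift (lactB_balanced x).
HB.instance Definition _ x :=
  GRing.Linear.copy (lactB x) (tlift (lactB_balanced x)).
Lemma lactBE x d e : lactB x (el_l d e) = el_l d (iB x *> e).
Proof. exact: tliftE. Qed.

Fact lactrB_balanced x : balanced (@lB K Q) (@lSB K Q)
  (fun d e => el_l d (e <* iB x)).
Proof. act_balanced. Qed.
Definition lactrB x : tens_l -> tens_l := tlift (lactrB_balanced x).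
HB.instance Definition _ x :=
  GRing.Linear.copy (lactrB x) (tlift (lactrB_balanced x)).
Lemma lactrBE x d e : lactrB x (el_l d e) = el_l d (e <* iB x).
Proof. exact: tliftE. Qed.

Fact ractC_balanced y : balanced (@rSC K Q) (@rC K Q)
  (fun d e => el_r (d <* iC y) e).
Proof. act_balanced. Qed.
Definition ractC y : tens_r -> tens_r := tlift (ractC_balanced y).
HB.instance Definition _ y :=
  GRing.Linear.copy (ractC y) (tlift (ractC_balanced y)).
Lemma ractCE y d e : ractC y (el_r d e) = el_r (d <* iC y) e.
Proof. exact: tliftE. Qed.

Fact ractlB_balanced x : balanced (@rSC K Q) (@rC K Q)
  (fun d e => el_r d (iB x *> e)).
Proof. act_balanced. Qed.
Definition ractlB x : tens_r -> tens_r := tlift (ractlB_balanced x).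
HB.instance Definition _ x :=
  GRing.Linear.copy (ractlB x) (tlift (ractlB_balanced x)).
Lemma ractlBE x d e : ractlB x (el_r d e) = el_r d (iB x *> e).
Proof. exact: tliftE. Qed.

Fact ractlC_balanced y : balanced (@rSC K Q) (@rC K Q)
  (fun d e => el_r d (iC y *> e)).
Proof. act_balanced. Qed.
Definition ractlC y : tens_r -> tens_r := tlift (ractlC_balanced y).
HB.instance Definition _ y :=
  GRing.Linear.copy (ractlC y) (tlift (ractlC_balanced y)).
Lemma ractlCE y d e : ractlC y (el_r d e) = el_r d (iC y *> e).
Proof. exact: tliftE. Qed.

Fact lact_balanced y x : balanced (@lB K Q) (@lSB K Q)
  (fun d e => el_l (lC y d) (lB x e)).
Proof. act_balanced. Qed.
Definition lact y x : tens_l -> tens_l := tlift (lact_balanced y x).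
HB.instance Definition _ y x :=
  GRing.Linear.copy (lact y x) (tlift (lact_balanced y x)).
Lemma lactE y x d e : lact y x (el_l d e) = el_l (iC y *> d) (iB x *> e).
Proof. exact: tliftE. Qed.

Fact ract_balanced y x : balanced (@rSC K Q) (@rC K Q)
  (fun d e => el_r (rC y d) (rB x e)).
Proof. act_balanced. Qed.
Definition ract y x : tens_r -> tens_r := tlift (ract_balanced y x).
HB.instance Definition _ y x :=
  GRing.Linear.copy (ract y x) (tlift (ract_balanced y x)).
Lemma ractE y x d e : ract y x (el_r d e) = el_r (d <* iC y) (e <* iB x).
Proof. exact: tliftE. Qed.

Lemma mulL12 b c t : mulL b c t = mulL1 b (mulL2 c t).
Proof.
elim/tens_l_ind: t => [|t t' ht ht'|d e]; rewrite ?linear0 //.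
  by rewrite !linearD /= ht ht'.
by rewrite mulLE mulL2E mulL1E.
Qed.
Lemma mulL21 b c t : mulL b c t = mulL2 c (mulL1 b t).
Proof.
elim/tens_l_ind: t => [|t t' ht ht'|d e]; rewrite ?linear0 //.
  by rewrite !linearD /= ht ht'.
by rewrite mulLE mulL1E mulL2E.
Qed.
Lemma mulR12 a b t : mulR a b t = mulR1 a (mulR2 b t).
Proof.
elim/tens_r_ind: t => [|t t' ht ht'|d e]; rewrite ?linear0 //.
  by rewrite !linearD /= ht ht'.
by rewrite mulRE mulR2E mulR1E.
Qed.
Lemma mulR21 a b t : mulR a b t = mulR2 b (mulR1 a t).
Proof.
elim/tens_r_ind: t => [|t t' ht ht'|d e]; rewrite ?linear0 //.
  by rewrite !linearD /= ht ht'.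
by rewrite mulRE mulR1E mulR2E.
Qed.
Lemma mulL1M b b' t : mulL1 b (mulL1 b' t) = mulL1 (b' ** b) t.
Proof.
elim/tens_l_ind: t => [|t t' ht ht'|d e]; rewrite ?linear0 //.
  by rewrite !linearD /= ht ht'.
by rewrite !mulL1E numulA.
Qed.
Lemma mulR1M b b' t : mulR1 b (mulR1 b' t) = mulR1 (b ** b') t.
Proof.
elim/tens_r_ind: t => [|t t' ht ht'|d e]; rewrite ?linear0 //.
  by rewrite !linearD /= ht ht'.
by rewrite !mulR1E numulA.
Qed.
Lemma mulL2M b b' t : mulL2 b (mulL2 b' t) = mulL2 (b' ** b) t.
Proof.
elim/tens_l_ind: t => [|t t' ht ht'|d e]; rewrite ?linear0 //.
  by rewrite !linearD /= ht ht'.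
by rewrite !mulL2E numulA.
Qed.
Lemma mulR2M b b' t : mulR2 b (mulR2 b' t) = mulR2 (b ** b') t.
Proof.
elim/tens_r_ind: t => [|t t' ht ht'|d e]; rewrite ?linear0 //.
  by rewrite !linearD /= ht ht'.
by rewrite !mulR2E numulA.
Qed.
Lemma fctr_mulL1 F b t : fctr F (mulL1 b t) = fctr F t ** b.
Proof.
elim/tens_l_ind: t => [|t t' ht ht'|d e]; rewrite ?linear0 ?numul0a //.
  by rewrite !linearD /= numulDl ht ht'.
by rewrite mulL1E !fctrE lmA.
Qed.
Lemma kctr_mulR1 F a t : kctr F (mulR1 a t) = a ** kctr F t.
Proof.
elim/tens_r_ind: t => [|t t' ht ht'|d e]; rewrite ?linear0 //.
  by rewrite !linearD /= ht ht'.
by rewrite mulR1E !kctrE rmA.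
Qed.
Lemma hctr_mulR2 F b t : hctr F (mulR2 b t) = b ** hctr F t.
Proof.
elim/tens_r_ind: t => [|t t' ht ht'|d e]; rewrite ?linear0 //.
  by rewrite !linearD /= ht ht'.
by rewrite mulR2E !hctrE rmA.
Qed.

(** * Comultiplications and their one-sided module relations *)

Section Bialgebroid.
Variable D : multiplier_bialgebroid Q.
Local Notation DeltaB := (@DeltaB K Q D).
Local Notation DeltaC := (@DeltaC K Q D).
Local Notation DeltaB_l := (@DeltaB_l K Q D).
Local Notation DeltaB_r := (@DeltaB_r K Q D).
Local Notation DeltaC_l := (@DeltaC_l K Q D).
Local Notation DeltaC_r := (@DeltaC_r K Q D).

Fact DeltaB_lin t : linear (DeltaB^~ t).
Proof. by move=> k a b; rewrite DeltaB_linear. Qed.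
Fact DeltaC_lin t : linear (DeltaC^~ t).
Proof. by move=> k a b; rewrite DeltaC_linear. Qed.
Lemma DeltaB0 t : DeltaB 0 t = 0.
Proof. by have [] := linear_mapE (DeltaB_lin t). Qed.
Lemma DeltaBD a b t : DeltaB (a + b) t = DeltaB a t + DeltaB b t.
Proof. by have [_ ->] := linear_mapE (DeltaB_lin t). Qed.
Lemma DeltaC0 t : DeltaC 0 t = 0.
Proof. by have [] := linear_mapE (DeltaC_lin t). Qed.
Lemma DeltaCD a b t : DeltaC (a + b) t = DeltaC a t + DeltaC b t.
Proof. by have [_ ->] := linear_mapE (DeltaC_lin t). Qed.

Lemma mulL2_DeltaB_l a d c : mulL2 c (DeltaB_l a d) = DeltaB a (el_l d c).
Proof. by rewrite DeltaB_lE. Qed.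
Lemma mulL1_DeltaB_r a b c : mulL1 b (DeltaB_r a c) = DeltaB a (el_l b c).
Proof. by rewrite DeltaB_rE. Qed.
Lemma mulR2_DeltaC_l a c b : mulR2 b (DeltaC_l a c) = DeltaC c (el_r a b).
Proof. by rewrite DeltaC_lE. Qed.
Lemma mulR1_DeltaC_r b c a : mulR1 a (DeltaC_r b c) = DeltaC c (el_r a b).
Proof. by rewrite DeltaC_rE. Qed.

Lemma mulL_DeltaB_l b c a d : mulL b c (DeltaB_l a d) = DeltaB a (el_l (d ** b) c).
Proof. by rewrite mulL12 mulL2_DeltaB_l -!mulL1_DeltaB_r mulL1M. Qed.
Lemma mulL_DeltaB_r b c a d : mulL b c (DeltaB_r a d) = DeltaB a (el_l b (d ** c)).
Proof. by rewrite mulL21 mulL1_DeltaB_r -!mulL2_DeltaB_l mulL2M. Qed.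
Lemma mulR_DeltaC_l a b c d : mulR a b (DeltaC_l c d) = DeltaC d (el_r (a ** c) b).
Proof. by rewrite mulR12 mulR2_DeltaC_l -!mulR1_DeltaC_r mulR1M. Qed.

Lemma mulL_DeltaB b c a t : mulL b c (DeltaB a t) = DeltaB a (mulL b c t).
Proof.
elim/tens_l_ind: t => [|t t' ht ht'|d e]; rewrite ?linear0 //.
  by rewrite !linearD /= ht ht'.
rewrite mulLE -[in LHS]mulL1_DeltaB_r mulL21 mulL1M mulL1_DeltaB_r.
by rewrite -!mulL2_DeltaB_l mulL2M.
Qed.
Lemma mulR_DeltaC b c a t : mulR b c (DeltaC a t) = DeltaC a (mulR b c t).
Proof.
elim/tens_r_ind: t => [|t t' ht ht'|d e]; rewrite ?linear0 //.
  by rewrite !linearD /= ht ht'.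
rewrite mulRE -[in LHS]mulR1_DeltaC_r mulR21 mulR1M mulR1_DeltaC_r.
by rewrite -!mulR2_DeltaC_l mulR2M.
Qed.

(** The bimodule axiom speaks only of [sandwich] products, but these span A, and x can be absorbed
    into the outer factor [x0]. The five relations that follow are obtained in the same way. *)
Lemma DeltaB_lact a x t : DeltaB (iB x *> a) t = lactB x (DeltaB a t).
Proof.
move: a; apply: sandwich_ind => [|a b ha hb|x0 y0 a x' y'].
- by rewrite linear0 !DeltaB0 linear0.
- by rewrite linearD !DeltaBD linearD /= ha hb.
have -> : iB x *> sandwich x0 y0 a x' y' = sandwich (x ** x0) y0 a x' y'.
  by rewrite /sandwich lBM !lrq.
rewrite !DeltaB_bimod.
change (lact y0 (x ** x0) (DeltaB a (tbimap (lC y') (lB x') t)) =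
        lactB x (lact y0 x0 (DeltaB a (tbimap (lC y') (lB x') t)))).
elim/tens_l_ind: (DeltaB a _) => [|s s' hs hs'|d e]; rewrite ?linear0 //.
  by rewrite !linearD /= hs hs'.
by rewrite !lactE lactBE lBM.
Qed.
Lemma DeltaB_ractB a x b c :
  DeltaB (a <* iB x) (el_l b c) = DeltaB a (el_l b (iB x *> c)).
Proof.
move: a; apply: sandwich_ind => [|a a' ha hb|x0 y0 a x' y'].
- by rewrite linear0 !DeltaB0.
- by rewrite linearD !DeltaBD /= ha hb.
have -> : sandwich x0 y0 a x' y' <* iB x = sandwich x0 y0 a (x' ** x) y'.
  by rewrite /sandwich rBM [in RHS]rBC.
rewrite !DeltaB_bimod; congr (tbimap _ _ (DeltaB a _)).
change (lact y' (x' ** x) (el_l b c) = lact y' x' (el_l b (iB x *> c))).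
by rewrite !lactE lBM.
Qed.
Lemma DeltaB_ractC a y b c :
  DeltaB (a <* iC y) (el_l b c) = DeltaB a (el_l (iC y *> b) c).
Proof.
move: a; apply: sandwich_ind => [|a a' ha hb|x0 y0 a x' y'].
- by rewrite linear0 !DeltaB0.
- by rewrite linearD !DeltaBD /= ha hb.
have -> : sandwich x0 y0 a x' y' <* iC y = sandwich x0 y0 a x' (y' ** y).
  by rewrite /sandwich rCM.
rewrite !DeltaB_bimod; congr (tbimap _ _ (DeltaB a _)).
change (lact (y' ** y) x' (el_l b c) = lact y' x' (el_l (iC y *> b) c)).
by rewrite !lactE lCM.
Qed.

Lemma DeltaC_ractC a y t : DeltaC (a <* iC y) t = ractC y (DeltaC a t).
Proof.
move: a; apply: sandwich_ind => [|a b ha hb|x0 y0 a x' y'].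
- by rewrite linear0 !DeltaC0 linear0.
- by rewrite linearD !DeltaCD linearD /= ha hb.
have -> : sandwich x0 y0 a x' y' <* iC y = sandwich x0 y0 a x' (y' ** y).
  by rewrite /sandwich rCM.
rewrite !DeltaC_bimod.
change (ract (y' ** y) x' (DeltaC a (tbimap (rC y0) (rB x0) t)) =
        ractC y (ract y' x' (DeltaC a (tbimap (rC y0) (rB x0) t)))).
elim/tens_r_ind: (DeltaC a _) => [|s s' hs hs'|d e]; rewrite ?linear0 //.
  by rewrite !linearD /= hs hs'.
by rewrite !ractE ractCE rCM.
Qed.
Lemma DeltaC_lactB a x b c :
  DeltaC (iB x *> a) (el_r b c) = DeltaC a (el_r b (c <* iB x)).
Proof.
move: a; apply: sandwich_ind => [|a a' ha hb|x0 y0 a x' y'].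
- by rewrite linear0 !DeltaC0.
- by rewrite linearD !DeltaCD /= ha hb.
have -> : iB x *> sandwich x0 y0 a x' y' = sandwich (x ** x0) y0 a x' y'.
  by rewrite /sandwich lBM !lrq.
rewrite !DeltaC_bimod; congr (tbimap _ _ (DeltaC a _)).
change (ract y0 (x ** x0) (el_r b c) = ract y0 x0 (el_r b (c <* iB x))).
by rewrite !ractE rBM.
Qed.
Lemma DeltaC_lactC a y b c :
  DeltaC (iC y *> a) (el_r b c) = DeltaC a (el_r (b <* iC y) c).
Proof.
move: a; apply: sandwich_ind => [|a a' ha hb|x0 y0 a x' y'].
- by rewrite linear0 !DeltaC0.
- by rewrite linearD !DeltaCD /= ha hb.
have -> : iC y *> sandwich x0 y0 a x' y' = sandwich x0 (y ** y0) a x' y'.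
  by rewrite /sandwich lCM !lrq -lBC.
rewrite !DeltaC_bimod; congr (tbimap _ _ (DeltaC a _)).
change (ract (y ** y0) x0 (el_r b c) = ract y0 x0 (el_r (b <* iC y) c)).
by rewrite !ractE rCM.
Qed.

(** * Coassociativity after contraction *)

Lemma same_image_comp (V W : lmodType K) (F : {linear V -> W})
    (I1 : Type) (f1 : I1 -> A -> A) (g1 : I1 -> A -> A) (beta1 : A -> A -> V)
    (t1 : tens f1 g1)
    (I2 : Type) (f2 : I2 -> A -> A) (g2 : I2 -> A -> A) (beta2 : A -> A -> V)
    (t2 : tens f2 g2) : same_image beta1 t1 beta2 t2 ->
  same_image (fun a b => F (beta1 a b)) t1 (fun a b => F (beta2 a b)) t2.
Proof.
have comp J (f g : J -> A -> A) (beta : A -> A -> V) :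
    balanced f g beta -> balanced f g (fun a b => F (beta a b)).
  case=> Dl Dr Zl Zr b; split=> *.
  - by rewrite Dl linearD.
  - by rewrite Dr linearD.
  - by rewrite Zl linearZ.
  - by rewrite Zr linearZ.
  - by rewrite b.
case=> b1 b2 e; split; [exact: comp|exact: comp|].
by rewrite /tmap -!linear_sum; congr (F _).
Qed.

Lemma same_image_ext (V : lmodType K)
    (I1 : Type) (f1 : I1 -> A -> A) (g1 : I1 -> A -> A) (beta1 gamma1 : A -> A -> V)
    (t1 : tens f1 g1)
    (I2 : Type) (f2 : I2 -> A -> A) (g2 : I2 -> A -> A) (beta2 gamma2 : A -> A -> V)
    (t2 : tens f2 g2) : beta1 =2 gamma1 -> beta2 =2 gamma2 ->
  same_image beta1 t1 beta2 t2 -> same_image gamma1 t1 gamma2 t2.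
Proof.
move=> e1 e2; have -> : beta1 = gamma1 by apply/funext => d; apply/funext/e1.
by have -> : beta2 = gamma2 by apply/funext => d; apply/funext/e2.
Qed.

Section Trilinear.
Variables (V : lmodType K) (psi : A -> A -> A -> V).

(** A map of three variables, balanced between the first two and between the last two, descends to
    the iterated tensor products in which coassociativity is stated. *)
Lemma balanced_iterated (I J : Type) (f : I -> A -> A) (g : I -> A -> A)
    (f' : J -> A -> A) (g' : J -> A -> A) :
  (forall w, balanced f g (fun u v => psi u v w)) ->
  (forall u v, linear (psi u v)) ->
  (forall j, balanced f g (fun u v => tensor f g u (f' j v))) ->
  (forall j u v w, psi u (f' j v) w = psi u v (g' j w)) ->
  balanced (fun j (t : tens f g) => tbimap id (f' j) t) g'
    (fun t w => tmap (fun u v => psi u v w) t).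
Proof.
move=> bal lin f'bal bal'.
have lift_w w t : tmap (fun u v => psi u v w) t = tlift (bal w) t by [].
split=> [t t' w|t w w'|k t w|k t w|j t w].
- by rewrite !lift_w linearD.
- rewrite /tmap -big_split; apply: eq_bigr => p _.
  by have [_ ->] := linear_mapE (lin p.1 p.2).
- by rewrite !lift_w linearZ.
- rewrite /tmap scaler_sumr; apply: eq_bigr => p _.
  exact: linear_mapZ (lin p.1 p.2) _ _.
elim/tens_ind: t => [|t t' ht ht'|u v].
- by rewrite [tbimap _ _ _](linear0 (tlift (f'bal j))) !lift_w !linear0.
- rewrite [tbimap _ _ _](linearD (tlift (f'bal j))) !lift_w !linearD /=.
  by rewrite -!lift_w -ht -ht'.
rewrite [tbimap _ _ _](tliftE (f'bal j)) !lift_w !tliftE.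
exact: bal'.
Qed.

Hypothesis psi_linear : forall u v, linear (psi u v).

(** This and its two variants are the form in which coassociativity is applied: a Sweedler
    computation becomes a choice of [psi]. The balancedness contained in [same_image] is also used,
    to build linear maps from one side. *)
Lemma DeltaCB_trilinear a b c :
  (forall w, balanced (@rSC K Q) (@rC K Q) (fun u v => psi u v w)) ->
  (forall x u v w, psi u (iB x *> v) w = psi u v (iC (SB x) *> w)) ->
  same_image (fun d e => tmap (fun u v => psi u v e) (DeltaC_l a d)) (DeltaB_r b c)
    (fun d e => tmap (fun p q => psi d p q) (DeltaB_r e c)) (DeltaC_l a b).
Proof.
move=> bal bal'; have pbal := balanced_iterated bal psi_linear
  ractlB_balanced bal'.
have := same_image_comp (tlift pbal) (DeltaCB_coassoc D a b c).
have E1 d e : tlift pbal (el_rl (DeltaC_l a d) e) =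
  tmap (fun u v => psi u v e) (DeltaC_l a d) by rewrite [LHS](tliftE pbal).
have E2 d e : tlift pbal (cons_rl d (DeltaB_r e c)) =
  tmap (fun p q => psi d p q) (DeltaB_r e c).
  rewrite /cons_rl {1}/tmap linear_sum; apply: eq_bigr => p _.
  by rewrite [LHS](tliftE pbal) (tmap_tensor (bal _)).
exact: same_image_ext E1 E2.
Qed.

Lemma DeltaBC_trilinear a b c :
  (forall w, balanced (@lB K Q) (@lSB K Q) (fun u v => psi u v w)) ->
  (forall y u v w, psi u (v <* iB (SC y)) w = psi u v (w <* iC y)) ->
  same_image (fun d e => tmap (fun u v => psi u v e) (DeltaB_l d a)) (DeltaC_r c b)
    (fun d e => tmap (fun p q => psi d p q) (DeltaC_r c e)) (DeltaB_l b a).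
Proof.
move=> bal bal'; have pbal := balanced_iterated bal psi_linear
  (fun y => lactrB_balanced (SC y)) bal'.
have := same_image_comp (tlift pbal) (DeltaBC_coassoc D a b c).
have E1 d e : tlift pbal (el_lr (DeltaB_l d a) e) =
  tmap (fun u v => psi u v e) (DeltaB_l d a) by rewrite [LHS](tliftE pbal).
have E2 d e : tlift pbal (cons_lr d (DeltaC_r c e)) =
  tmap (fun p q => psi d p q) (DeltaC_r c e).
  rewrite /cons_lr {1}/tmap linear_sum; apply: eq_bigr => p _.
  by rewrite [LHS](tliftE pbal) (tmap_tensor (bal _)).
exact: same_image_ext E1 E2.
Qed.

Lemma DeltaB_trilinear a b c :
  (forall w, balanced (@lB K Q) (@lSB K Q) (fun u v => psi u v w)) ->
  (forall x u v w, psi u (iB x *> v) w = psi u v (iC (SB x) *> w)) ->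
  same_image (fun d e => tmap (fun u v => psi u v e) (DeltaB_l d a)) (DeltaB_r b c)
    (fun d e => tmap (fun p q => psi d p q) (DeltaB_r e c)) (DeltaB_l b a).
Proof.
move=> bal bal'; have pbal := balanced_iterated bal psi_linear
  lactB_balanced bal'.
have := same_image_comp (tlift pbal) (DeltaB_coassoc D a b c).
have E1 d e : tlift pbal (el_ll (DeltaB_l d a) e) =
  tmap (fun u v => psi u v e) (DeltaB_l d a) by rewrite [LHS](tliftE pbal).
have E2 d e : tlift pbal (cons_ll d (DeltaB_r e c)) =
  tmap (fun p q => psi d p q) (DeltaB_r e c).
  rewrite /cons_ll {1}/tmap linear_sum; apply: eq_bigr => p _.
  by rewrite [LHS](tliftE pbal) (tmap_tensor (bal _)).
exact: same_image_ext E1 E2.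
Qed.

End Trilinear.

Lemma gctr_lactB F x t : gctr F (lactB x t) = iB x *> gctr F t.
Proof.
elim/tens_l_ind: t => [|t t' ht ht'|d e]; rewrite ?linear0 //.
  by rewrite !linearD /= ht ht'.
by rewrite lactBE !gctrE lBC.
Qed.
Lemma hctr_ractlB F x t : hctr F (ractlB x t) = iB x *> hctr F t.
Proof.
elim/tens_r_ind: t => [|t t' ht ht'|d e]; rewrite ?linear0 //.
  by rewrite !linearD /= ht ht'.
by rewrite ractlBE !hctrE lrq.
Qed.
Lemma hctr_ractlC F y t : hctr F (ractlC y t) = iC y *> hctr F t.
Proof.
elim/tens_r_ind: t => [|t t' ht ht'|d e]; rewrite ?linear0 //.
  by rewrite !linearD /= ht ht'.
by rewrite ractlCE !hctrE lrq.
Qed.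

(** The axioms describe [DeltaB_l] and its analogues through their products with elements in the
    other leg, so multiplicativity and the module relations come out up to [eqL] or [eqR]. *)
Lemma eqL_DeltaB_lM a a' d : eqL (DeltaB_l (a ** a') d) (DeltaB a (DeltaB_l a' d)).
Proof. by move=> b c; rewrite mulL_DeltaB !mulL_DeltaB_l DeltaBM. Qed.
Lemma eqL_DeltaB_rM a a' d : eqL (DeltaB_r (a ** a') d) (DeltaB a (DeltaB_r a' d)).
Proof. by move=> b c; rewrite mulL_DeltaB !mulL_DeltaB_r DeltaBM. Qed.
Lemma eqR_DeltaC_lM a a' d : eqR (DeltaC_l d (a ** a')) (DeltaC a' (DeltaC_l d a)).
Proof. by move=> b c; rewrite mulR_DeltaC !mulR_DeltaC_l DeltaCM. Qed.

Lemma eqR_DeltaC a t t' : eqR t t' -> eqR (DeltaC a t) (DeltaC a t').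
Proof. by move=> h b c; rewrite !mulR_DeltaC h. Qed.

Lemma eqL_DeltaB_l_rB x a d : eqL (DeltaB_l (a <* iB x) d) (lactrB x (DeltaB_l a d)).
Proof.
move=> b c; have -> t : mulL b c (lactrB x t) = mulL b (iB x *> c) t.
  elim/tens_l_ind: t => [|t t' ht ht'|u v]; rewrite ?linear0 //.
    by rewrite !linearD /= ht ht'.
  by rewrite lactrBE !mulLE lrA.
by rewrite !mulL_DeltaB_l DeltaB_ractB.
Qed.
Lemma eqL_DeltaB_r_lB x a d : eqL (DeltaB_r (iB x *> a) d) (lactB x (DeltaB_r a d)).
Proof.
move=> b c; have -> t : mulL b c (lactB x t) = lactB x (mulL b c t).
  elim/tens_l_ind: t => [|t t' ht ht'|u v]; rewrite ?linear0 //.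
    by rewrite !linearD /= ht ht'.
  by rewrite !(lactBE, mulLE) lmA.
by rewrite !mulL_DeltaB_r DeltaB_lact.
Qed.
Lemma eqR_DeltaC_l_lB x a d : eqR (DeltaC_l d (iB x *> a)) (ractlB x (DeltaC_l d a)).
Proof.
move=> b c; have -> t : mulR b c (ractlB x t) = mulR b (c <* iB x) t.
  elim/tens_r_ind: t => [|t t' ht ht'|u v]; rewrite ?linear0 //.
    by rewrite !linearD /= ht ht'.
  by rewrite ractlBE !mulRE lrA.
by rewrite !mulR_DeltaC_l DeltaC_lactB.
Qed.
Lemma eqR_DeltaC_l_lC y a d :
  eqR (DeltaC_l (d <* iB (SC y)) a) (ractlC y (DeltaC_l d a)).
Proof.
move=> b c; have -> t : mulR b c (ractlC y t) = mulR b (c <* iC y) t.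
  elim/tens_r_ind: t => [|t t' ht ht'|u v]; rewrite ?linear0 //.
    by rewrite !linearD /= ht ht'.
  by rewrite ractlCE !mulRE lrA.
by rewrite !mulR_DeltaC_l -rmA el_r_bal.
Qed.
Lemma eqR_DeltaC_l_rC y a d : eqR (DeltaC_l d (a <* iC y)) (ractC y (DeltaC_l d a)).
Proof.
move=> b c; have -> t : mulR b c (ractC y t) = ractC y (mulR b c t).
  elim/tens_r_ind: t => [|t t' ht ht'|u v]; rewrite ?linear0 //.
    by rewrite !linearD /= ht ht'.
  by rewrite !(ractCE, mulRE) rmA.
by rewrite !mulR_DeltaC_l DeltaC_ractC.
Qed.

(** * Canonical maps *)

Section Canonical.
Hypothesis hD : regular_multiplier_hopf_algebroid D.

(** Surjectivity of a canonical map turned into induction: a linear property of tensors may be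
    checked on its values. *)
Fact surj_ind (V : lmodType K) (I : Type) (f g : I -> A -> A) (beta : A -> A -> V)
    (P : V -> Prop) : induces_bijection f g beta ->
  P 0 -> (forall t t', P t -> P t' -> P (t + t')) ->
  (forall a b, P (beta a b)) -> forall t, P t.
Proof.
move=> [bal [inv _ invK]] P0 PD Pb t; rewrite -[t]invK.
rewrite -[tmap beta]/(tlift bal : _ -> _).
elim/tens_ind: (inv t) => [|s s' hs hs'|a b]; first by rewrite linear0.
  by rewrite linearD; apply: PD.
by rewrite tliftE.
Qed.
Lemma DeltaB_l_ind (P : tens_l -> Prop) : P 0 ->
  (forall t t', P t -> P t' -> P (t + t')) ->
  (forall a b, P (DeltaB_l b a)) -> forall t, P t.
Proof. exact: surj_ind (T_lambda hD). Qed.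
Lemma DeltaB_r_ind (P : tens_l -> Prop) : P 0 ->
  (forall t t', P t -> P t' -> P (t + t')) ->
  (forall a b, P (DeltaB_r a b)) -> forall t, P t.
Proof. exact: surj_ind (T_rho hD). Qed.
Lemma DeltaC_l_ind (P : tens_r -> Prop) : P 0 ->
  (forall t t', P t -> P t' -> P (t + t')) ->
  (forall a b, P (DeltaC_l a b)) -> forall t, P t.
Proof. exact: surj_ind (lambda_T hD). Qed.
Lemma DeltaC_r_ind (P : tens_r -> Prop) : P 0 ->
  (forall t t', P t -> P t' -> P (t + t')) ->
  (forall a b, P (DeltaC_r b a)) -> forall t, P t.
Proof. exact: surj_ind (rho_T hD). Qed.

Fact DeltaB_l_linl a : linear (DeltaB_l^~ a).
Proof.
by move=> k b b'; rewrite (balanced_Dr (T_lambda hD).1)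
  (balanced_Zr (T_lambda hD).1).
Qed.
Fact DeltaB_r_linl b : linear (DeltaB_r^~ b).
Proof.
by move=> k a a'; rewrite (balanced_Dl (T_rho hD).1) (balanced_Zl (T_rho hD).1).
Qed.
Fact DeltaC_l_linl b : linear (DeltaC_l^~ b).
Proof.
by move=> k a a'; rewrite (balanced_Dl (lambda_T hD).1)
  (balanced_Zl (lambda_T hD).1).
Qed.
Fact DeltaC_l_linr a : linear (DeltaC_l a).
Proof.
by move=> k b b'; rewrite (balanced_Dr (lambda_T hD).1)
  (balanced_Zr (lambda_T hD).1).
Qed.
Fact DeltaC_r_linr b : linear (DeltaC_r b).
Proof.
by move=> k a a'; rewrite (balanced_Dl (rho_T hD).1) (balanced_Zl (rho_T hD).1).
Qed.
Lemma DeltaB_l_bal a b y : DeltaB_l b (iC y *> a) = DeltaB_l (b <* iC y) a.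
Proof. exact: balanced_bal (T_lambda hD).1 y a b. Qed.
Lemma DeltaB_r_bal a b x : DeltaB_r (a <* iB x) b = DeltaB_r a (iB x *> b).
Proof. exact: balanced_bal (T_rho hD).1 x a b. Qed.

End Canonical.

(** * Slices and invariance *)

Hypothesis hD : regular_multiplier_hopf_algebroid D.

Variables (epsB : A -> B) (hepsB : left_counit D epsB).
Variables (epsC : A -> C) (hepsC : right_counit D epsC).
Variables (muB : {scalar B}) (muC : {scalar C}).
Hypothesis hmu : base_weight epsB epsC muB muC.
Local Notation muBf := (muB_faithful hmu).
Local Notation muCf := (muC_faithful hmu).
Local Notation mu_SC := (muB_SC hmu).
Local Notation mu_SB := (muC_SB hmu).
Local Notation adfun := (adfun muB muC).
Local Notation Bl := (Bl muBf).
Local Notation Br := (Br muBf).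
Local Notation Cl := (Cl muCf).
Local Notation Cr := (Cr muCf).

Definition epsBl : lBmap := Equimap (epsB_linear hepsB) (epsB_lB hepsB).
Definition epsCr : rCmap := Equimap (epsC_linear hepsC)
  (fun y a => epsC_rC hepsC a y).
Fact epsSB_linear : linear (fun a => SB (epsB a)).
Proof. by move=> k a b; rewrite (epsB_linear hepsB) linearP. Qed.
Fact epsSBE y a : SB (epsB (lC y a)) = y ** SB (epsB a).
Proof. by rewrite -{1}(SBinvK y) (epsB_lSB hepsB) SB_anti SBinvK. Qed.
(** The left counit moved into C. The relation epsB(S_B(x)a) = epsB(a)x makes it left C-linear, so
    that the second counit identity is also a contraction, see [counit_Bl]. *)
Definition epsSB : lCmap := Equimap epsSB_linear epsSBE.
Fact epsSC_linear : linear (fun a => SC (epsC a)).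
Proof. by move=> k a b; rewrite (epsC_linear hepsC) linearP. Qed.
Fact epsSCE x a : SC (epsC (rB x a)) = SC (epsC a) ** x.
Proof. by rewrite -{1}(SCinvK x) (epsC_rSC hepsC) SC_anti SCinvK. Qed.
Definition epsSC : rBmap := Equimap epsSC_linear epsSCE.

Lemma counit_Br a b : gctr epsBl (DeltaB_r a b) = a ** b.
Proof. exact: epsB_counit_r hepsB a b. Qed.
Lemma counit_Bl a b : fctr epsSB (DeltaB_l b a) = b ** a.
Proof.
rewrite -(epsB_counit_l hepsB); apply: tmap_ext => d e.
by rewrite /= SBK.
Qed.
Lemma counit_Cr a b : hctr epsSC (DeltaC_r b a) = b ** a.
Proof.
rewrite -(epsC_counit_r hepsC); apply: tmap_ext => d e.
by rewrite /= SCK.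
Qed.
Lemma counit_Cl a b : kctr epsCr (DeltaC_l a b) = a ** b.
Proof. exact: epsC_counit_l hepsC a b. Qed.

(* In Sweedler notation, [sliceL w b x] is x_(1) w(x_(2) b), [sliceE w x b] is
   b_(1) w(x b_(2)), [sliceM w b x] is w(b x_(1)) x_(2) and [sliceN w c b] is
   w(b_(1) c) b_(2), the factors of w taking the place of w. *)
Definition sliceL (w : adfun) b x : A := fctr (Cl w) (DeltaB_r x b).
Definition sliceE (w : adfun) x b : A := kctr (Cr w) (DeltaC_r x b).
Definition sliceM (w : adfun) b x : A := hctr (Br w) (DeltaC_l b x).
Definition sliceN (w : adfun) c b : A := gctr (Bl w) (DeltaB_l b c).

Section Slices.
Variable w : adfun.
Local Notation L := (sliceL w).
Local Notation E := (sliceE w).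
Local Notation M := (sliceM w).
Local Notation N := (sliceN w).

Fact sliceL_lin b : linear (L b).
Proof. by move=> k x y; rewrite /sliceL (DeltaB_r_linl hD b) linearP. Qed.
Fact sliceE_lin x : linear (E x).
Proof. by move=> k b c; rewrite /sliceE (DeltaC_r_linr hD x) linearP. Qed.
Fact sliceM_lin b : linear (M b).
Proof. by move=> k x y; rewrite /sliceM (DeltaC_l_linr hD b) linearP. Qed.
Fact sliceM_linl x : linear (M^~ x).
Proof. by move=> k b c; rewrite /sliceM (DeltaC_l_linl hD x) linearP. Qed.

Lemma sliceL_rC b x y : L b (x <* iC y) = L b x <* iC y.
Proof.
apply: (numul_eql ndA) => c; rewrite -lrA -!fctr_mulL1.
by rewrite !mulL1_DeltaB_r DeltaB_ractC.
Qed.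
Lemma sliceE_lC x b y : E x (iC y *> b) = iC y *> E x b.
Proof.
apply: (numul_eqr ndA) => c; rewrite lrA -!kctr_mulR1.
by rewrite !mulR1_DeltaC_r DeltaC_lactC.
Qed.

(** The counit identity for [DeltaB_r] followed by Fubini; mu_B o epsB = mu_C o epsC allows the
    right counit on the left side. *)
Lemma mu_epsC_sliceL b x : muC (epsC (L b x)) = w (x ** b).
Proof. by rewrite -(mu_counit hmu) -counit_Br (ad_gctr muCf mu_SB). Qed.
Lemma mu_epsB_sliceE x b : muB (epsB (E x b)) = w (x ** b).
Proof. by rewrite (mu_counit hmu) -counit_Cr (ad_hctr muCf mu_SC) /= mu_SC. Qed.

Fact sliceLC_linear (F : rCmap) b : linear (fun a => F (L b a)).
Proof. by move=> k x y; rewrite sliceL_lin linearP. Qed.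
Fact sliceLCE (F : rCmap) b y a : F (L b (rC y a)) = F (L b a) ** y.
Proof. by rewrite sliceL_rC rCmapE. Qed.
Definition sliceLC F b : rCmap := Equimap (sliceLC_linear F b) (sliceLCE F b).
Fact sliceEC_linear (F : lCmap) x : linear (fun a => F (E x a)).
Proof. by move=> k a b; rewrite sliceE_lin linearP. Qed.
Fact sliceECE (F : lCmap) x y a : F (E x (lC y a)) = y ** F (E x a).
Proof. by rewrite sliceE_lC lCmapE. Qed.
Definition sliceEC F x : lCmap := Equimap (sliceEC_linear F x) (sliceECE F x).

(** Both sides equal mu_B(epsB(ab)): the weights move epsB(b) next to a, once through B and once
    through C, and the two product rules of epsB apply. *)
Lemma epsC_epsB_modular a b :
  muB (SC (epsC a) ** epsB b) = muB (epsB b ** SB' (epsC a)).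
Proof.
rewrite (muB_SCl mu_SC) -(muC_SBr mu_SB) -(epsC_rSC hepsC) -(epsC_rC hepsC).
rewrite -!(mu_counit hmu) SCinvK.
by rewrite -(epsB_mul hepsB) -(epsB_mulS hepsB).
Qed.

(** After multiplication by y = epsC(a), transported to B, and evaluation of mu_B, both sides become
    w(c y d). Here [epsC_epsB_modular] lets y change sides; a test element x of B is absorbed into
    a. *)
Lemma epsB_sliceE c d : epsB (E c d) = SC (epsC (L d c)).
Proof.
have mulJ a : SC (epsC a) ** epsB (E c d) = SC (epsC a) ** SC (epsC (L d c)).
  apply: (faithful_eqr muBf) => x; rewrite !numulA.
  have -> : x ** SC (epsC a) = SC (epsC (a <* iC (SC' x))).
    by rewrite (epsC_rC hepsC) SC_anti SCinvK.
  move: (a <* _) => {}a; rewrite epsC_epsB_modular.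
  rewrite -(epsB_lSB hepsB) SBinvK -sliceE_lC mu_epsB_sliceE.
  by rewrite -SC_anti mu_SC -(epsC_rC hepsC) -sliceL_rC mu_epsC_sliceL lrA.
(* The counit identity expresses ab through elements u S_C(epsC(v)), so the left factor of [mulJ]
   can be cancelled. *)
apply: rB_inj => b; apply: (numul_eqr ndA) => a.
rewrite -!rmA -counit_Cl; move: (DeltaC_l a b).
elim/tens_r_ind => [|t t' ht ht'|u v]; rewrite ?linear0 //.
  by rewrite !linearD /= ht ht'.
by rewrite !kctrE -!rBM mulJ.
Qed.

End Slices.

Variable phi : adfun.
Hypothesis phi_faithful : faithful phi.
Local Notation eqf := (fctr_eqL muBf mu_SB phi_faithful).
Local Notation eqg := (gctr_eqL muCf mu_SB phi_faithful).
Local Notation eqk := (kctr_eqR muBf mu_SC phi_faithful).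
Local Notation eqh := (hctr_eqR muCf mu_SC phi_faithful).

Section Coassociative.
Variable w : adfun.
Local Notation L := (sliceL w).
Local Notation E := (sliceE w).
Local Notation M := (sliceM w).
Local Notation N := (sliceN w).

(** Both sides are c x_(1) F(x_(2) w(x_(3) b)), by mixed coassociativity. *)
Lemma kctr_sliceL (F : rCmap) c b x :
  kctr F (DeltaC_l c (L b x)) = kctr (sliceLC w F b) (DeltaC_l c x).
Proof.
pose psi u v z : A := u <* iB (SC (F (iB (SB' (Cl w z)) *> v))).
have psi_lin u v : linear (psi u v).
  by move=> k z z'; rewrite /psi; bilinear.
have bal z : balanced (@rSC K Q) (@rC K Q) (fun u v => psi u v z).
  split=> *; rewrite /psi; try by bilinear.
  by rewrite /rSC /rC -lrq rCmapE SC_anti rBM.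
have [//||_ _ coassoc] := DeltaCB_trilinear psi_lin c x b.
  by move=> x' u v z; rewrite /psi lCmapE SB'_anti SBK lBM.
have lin : linear (fun d => kctr F (DeltaC_l c d)).
  by move=> k a a'; rewrite (DeltaC_l_linr hD c) linearP.
rewrite /sliceL /fctr /tlift (tmap_lin _ _ lin).
transitivity (tmap (fun d e => tmap (fun u v => psi u v e) (DeltaC_l c d))
  (DeltaB_r x b)).
  apply: tmap_ext => d e; rewrite (eqk _ (eqR_DeltaC_l_lB _ _ _)).
  rewrite -[tmap _ _]/(tlift (bal e) _).
  elim/tens_r_ind: (DeltaC_l c d) => [|t t' ht ht'|u v]; rewrite ?linear0 //.
    by rewrite !linearD /= ht ht'.
  by rewrite ractlBE kctrE tliftE.
rewrite coassoc; apply: tmap_ext => d z.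
have lin' : linear (fun a => d <* iB (SC (F a))) by move=> k a a'; bilinear.
by rewrite /= /sliceL /fctr /tlift (tmap_lin _ _ lin').
Qed.

(** Both sides are F(b_(2) w(x b_(3))) b_(1) a, by the other mixed coassociativity. *)
Lemma fctr_sliceE (F : lCmap) x b a :
  fctr F (DeltaB_l (E x b) a) = fctr (sliceEC w F x) (DeltaB_l b a).
Proof.
pose psi u v z : A := iB (SB' (F (v <* iB (SC (Cr w z))))) *> u.
have psi_lin u v : linear (psi u v).
  by move=> k z z'; rewrite /psi; bilinear.
have bal z : balanced (@lB K Q) (@lSB K Q) (fun u v => psi u v z).
  split=> *; rewrite /psi; try by bilinear.
  by rewrite /lB /lSB lrq lCmapE SB'_anti SBK lBM.
have [//||_ _ coassoc] := DeltaBC_trilinear psi_lin a b x.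
  by move=> y u v z; rewrite /psi rCmapE SC_anti rBM.
have lin : linear (fun d => fctr F (DeltaB_l d a)).
  by move=> k d d'; rewrite (DeltaB_l_linl hD a) linearP.
rewrite /sliceE /kctr /tlift (tmap_lin _ _ lin).
transitivity (tmap (fun d e => tmap (fun u v => psi u v e) (DeltaB_l d a))
  (DeltaC_r x b)).
  apply: tmap_ext => d e; rewrite (eqf _ (eqL_DeltaB_l_rB _ _ _)).
  rewrite -[tmap _ _]/(tlift (bal e) _).
  elim/tens_l_ind: (DeltaB_l d a) => [|t t' ht ht'|u v]; rewrite ?linear0 //.
    by rewrite !linearD /= ht ht'.
  by rewrite lactrBE fctrE tliftE.
rewrite coassoc; apply: tmap_ext => d z.
have lin' : linear (fun a' => iB (SB' (F a')) *> d) by move=> k a' a''; bilinear.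
by rewrite /= /sliceE /kctr /tlift (tmap_lin _ _ lin').
Qed.

Lemma mul_sliceL c b x : c ** L b x = kctr (sliceLC w epsCr b) (DeltaC_l c x).
Proof. by rewrite -kctr_sliceL counit_Cl. Qed.
Lemma sliceE_mul x b a : E x b ** a = fctr (sliceEC w epsSB x) (DeltaB_l b a).
Proof. by rewrite -fctr_sliceE counit_Bl. Qed.

End Coassociative.

(** C need not contain a unit to insert; the elements ya, which span A, take its place. *)
Lemma ad_muCl (w : adfun) a : w a = muC (Cl w a).
Proof.
move: a; apply: lC_ind => [|a b ha hb|x a]; rewrite ?linear0 //.
  by rewrite !linearD; congr (_ + _).
by rewrite (adCl muCf) lCmapE.
Qed.

Definition left_invariant (w : adfun) := forall a b,
  fctr (Cl w) (DeltaB_l b a) = iC (Cl w b) *> a.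
Definition right_invariant (w : adfun) := forall a b,
  gctr (Bl w) (DeltaB_r a b) = iB (Bl w a) *> b.

(** Invariance and the balancing of [DeltaB_l] over C make [Cl w] right C-linear as well; both
    factors then represent w(y b y'). *)
Lemma left_invariant_Clr w : left_invariant w -> forall a, Cl w a = Cr w a.
Proof.
move=> inv.
have ClM b y : Cl w (b <* iC y) = Cl w b ** y.
  by apply: lC_inj => a; rewrite -inv -(DeltaB_l_bal hD) inv lCM.
apply: lC_ind => [|a b ha hb|y a]; first by rewrite !linear0.
  by rewrite !linearD; congr (_ + _).
apply: (faithful_eql muCf) => y'.
rewrite -(adCr muCf) lCmapE -numulA -ClM lrq.
by rewrite (adCl muCf).
Qed.
Lemma right_invariant_Blr w : right_invariant w -> forall a, Bl w a = Br w a.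
Proof.
move=> inv.
have BlM b y : Bl w (b <* iB y) = Bl w b ** y.
  by apply: lB_inj => a; rewrite -inv (DeltaB_r_bal hD) inv lBM.
apply: lB_ind => [|a b ha hb|y a]; first by rewrite !linear0.
  by rewrite !linearD; congr (_ + _).
apply: (faithful_eql muBf) => y'.
rewrite -(adBr muBf) lBmapE -numulA -BlM lrq.
by rewrite (adBl muBf).
Qed.

Lemma surj_seq (V : lmodType K) (I : Type) (f g : I -> A -> A)
    (beta : A -> A -> V) : induces_bijection f g beta ->
  forall t, exists s : seq (A * A), t = \sum_(p <- s) beta p.1 p.2.
Proof.
move=> bij; apply: (surj_ind bij) => [|t t' [s ->] [s' ->]|a b].
- by exists [::]; rewrite big_nil.
- by exists (s ++ s'); rewrite big_cat.
by exists [:: (a, b)]; rewrite big_seq1.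
Qed.
Lemma tens_seq (M N : lmodType K) (I : Type) (f : I -> M -> M) (g : I -> N -> N)
  (t : tens f g) : exists s : seq (M * N), t = \sum_(p <- s) tensor f g p.1 p.2.
Proof.
elim/tens_ind: t => [|t t' [s ->] [s' ->]|a b].
- by exists [::]; rewrite big_nil.
- by exists (s ++ s'); rewrite big_cat.
by exists [:: (a, b)]; rewrite big_seq1.
Qed.

(** * Comparison of a right integral with phi *)

Hypothesis phi_inv : left_invariant phi.
Hypothesis phiB_onto : forall x, exists a, Bl phi a = x.
Hypothesis phiBr_onto : forall x, exists a, Br phi a = x.
Local Notation phiC := (left_invariant_Clr phi_inv).

(* [density psi a a'] says that a' plays the role of a delta, where
   psi = phi (- delta). *)
Definition density (psi : adfun) a a' : Prop :=
  psi a = phi a' /\ forall x, psi (x ** a) = phi (x ** a').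

Lemma densityD psi a a' b b' :
  density psi a a' -> density psi b b' -> density psi (a + b) (a' + b').
Proof.
move=> [h1 h2] [h3 h4]; split; first by rewrite !linearD /= h1 h3.
by move=> x; rewrite !linearD /= h2 h4.
Qed.
Lemma density0 psi : density psi 0 0.
Proof. by split=> [|x]; rewrite !linear0. Qed.

Section Density.
Variable psi : adfun.
Hypothesis psi_inv : right_invariant psi.

Lemma phi_gctr_psi t : phi (gctr (Bl psi) t) = psi (fctr (Cl phi) t).
Proof. by rewrite ad_muCl (ad_fctr muBf mu_SB). Qed.

(** By right invariance psi(r phi_B(s)) is phi o (psi (x) id) at Delta_B(r)(1 (x) s); by left
    invariance phi(p psi_C(q)) is the same functional at Delta_B(p)(q (x) 1). Applying Delta_B(x) to
    the given equality first yields the second clause of [density]. *)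
Lemma density_sum (s s' : seq (A * A)) :
  \sum_(p <- s) DeltaB_r p.1 p.2 = \sum_(p <- s') DeltaB_l p.2 p.1 ->
  density psi (\sum_(p <- s) p.1 <* iB (Bl phi p.2))
    (\sum_(p <- s') p.2 <* iC (Cl psi p.1)).
Proof.
have psiB r b : psi (r <* iB (Bl phi b)) = phi (gctr (Bl psi) (DeltaB_r r b)).
  by rewrite (adBr muBf) -(right_invariant_Blr psi_inv) -(adBl muBf) psi_inv.
have phiCl p q :
    phi (p <* iC (Cl psi q)) = phi (gctr (Bl psi) (DeltaB_l p q)).
  rewrite phi_gctr_psi phi_inv (adCl muCf) (adCr muCf).
  by rewrite phiC.
move=> e; split=> [|x].
  rewrite !linear_sum /= (eq_bigr _ (fun p _ => psiB p.1 p.2)).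
  by rewrite (eq_bigr _ (fun p _ => phiCl p.2 p.1)) -!linear_sum e.
rewrite !linear_sum /=.
have F1 p : psi (x ** (p.1 <* iB (Bl phi p.2))) =
    phi (gctr (Bl psi) (DeltaB x (DeltaB_r p.1 p.2))).
  by rewrite -rmA psiB (eqg _ (eqL_DeltaB_rM _ _ _)).
have F2 p : phi (x ** (p.2 <* iC (Cl psi p.1))) =
    phi (gctr (Bl psi) (DeltaB x (DeltaB_l p.2 p.1))).
  by rewrite -rmA phiCl (eqg _ (eqL_DeltaB_lM _ _ _)).
rewrite (eq_bigr _ (fun p _ => F1 p)) (eq_bigr _ (fun p _ => F2 p)).
by rewrite -!linear_sum e.
Qed.

(** Since A = AB and phi_B is onto, A is spanned by elements r phi_B(b); [T_lambda] rewrites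
    Delta_B(r)(1 (x) b) in the form needed by [density_sum]. *)
Lemma density_exists a : exists a', density psi a a'.
Proof.
move: a; apply: rB_ind => [|a b [a' ha] [b' hb]|x r].
- by exists 0; apply: density0.
- by exists (a' + b'); apply: densityD.
have [b <-] := phiB_onto x.
have [s' e] := surj_seq (T_lambda hD) (DeltaB_r r b).
exists (\sum_(p <- s') p.2 <* iC (Cl psi p.1)).
by have := @density_sum [:: (r, b)] s'; rewrite !big_seq1; apply.
Qed.

Lemma density_onto : (forall y, exists a, Cl psi a = y) ->
  forall a', exists a, density psi a a'.
Proof.
move=> onto; apply: rC_ind => [|a' b' [a ha] [b hb]|y p].
- by exists 0; apply: density0.
- by exists (a + b); apply: densityD.
have [q <-] := onto y.
have [s e] := surj_seq (T_rho hD) (DeltaB_l p q).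
exists (\sum_(p <- s) p.1 <* iB (Bl phi p.2)).
by have := @density_sum s [:: (q, p)]; rewrite !big_seq1; apply.
Qed.

(** Without a unit, psi(Am) = 0 does not give psi(m) = 0 at once; the first clause of [density]
    supplies it even if psi is not faithful. *)
Lemma density_eq0 m : (forall x, psi (x ** m) = 0) -> psi m = 0.
Proof.
move=> h; have [m' [-> hm']] := density_exists m.
suff -> : m' = 0 by rewrite linear0.
by apply: (faithful_injr phi_faithful) => x; rewrite -hm' h.
Qed.

(** Only the second clause passes to products directly. A density of ya is therefore taken from
    [density_exists] and identified with ya' by faithfulness of phi. *)
Lemma density_lC a a' y : density psi a a' -> density psi (iC y *> a) (iC y *> a').
Proof.
move=> [h1 h2]; have [b [hb1 hb2]] := density_exists (iC y *> a).
suff <- : b = iC y *> a' by [].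
by apply: (phi_eqr phi_faithful) => x; rewrite -hb2 !lrA h2.
Qed.

Lemma density_Cl a a' : density psi a a' -> Cl psi a = Cl phi a'.
Proof.
move=> d; apply: (faithful_eqr muCf) => y; rewrite -!(adCl muCf).
by case: (density_lC y d).
Qed.

End Density.

(** Derives left invariance for Delta_C, on products, from the one for Delta_B: (e (x) 1)Delta_C(b')
    is expanded into elementary tensors, and [slice_sum] trades this expansion for an application of
    Delta_B(b'). *)
Lemma kctr_phi_mul e b' b :
  kctr (Cr phi) (DeltaC_l e (b' ** b)) = e <* iC (Cr phi (b' ** b)).
Proof.
apply: (numul_eql ndA) => a; rewrite (eqk _ (eqR_DeltaC_lM _ _ _)) -lrA -phiC.
rewrite -phi_inv (eqf _ (eqL_DeltaB_lM _ _ _)).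
have [s es] : exists s : seq (A * A), DeltaC_l e b' = \sum_(p <- s) el_r p.1 p.2.
  exact: tens_seq.
(* On t = f (x) d both sides equal e [sliceL phi d b'] f, by [mul_sliceL] and [epsB_sliceE]. *)
have slice_sum t : \sum_(p <- s) p.1 ** fctr (sliceEC phi epsSB p.2) t =
    e ** fctr (Cl phi) (DeltaB b' t).
  elim/tens_l_ind: t => [|t t' ht ht'|f d].
  - by rewrite !linear0 big1 // => p _; rewrite !linear0.
  - rewrite !linearD /= -ht -ht' -big_split; apply: eq_bigr => p _ /=.
    by rewrite !linearD.
  rewrite -mulL1_DeltaB_r fctr_mulL1 numulA -[fctr _ _]/(sliceL phi d b').
  rewrite mul_sliceL es linear_sum numul_suml; apply: eq_bigr => p _ /=.
  by rewrite fctrE kctrE -lrA /= SBK epsB_sliceE.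
rewrite es linear_sum linear_sum numul_suml -slice_sum; apply: eq_bigr => p _ /=.
rewrite -mulR1_DeltaC_r kctr_mulR1 -numulA; congr (_ ** _).
by rewrite -[kctr _ _]/(sliceE phi p.2 b) sliceE_mul.
Qed.

(** Strong invariance before the antipode is available: multiply the expansion of a (x) b by
    Delta_B(x) and contract the second leg using the invariance of phi. *)
Lemma sliceL_strong a b x (s : seq (A * A)) :
  el_l a b = \sum_(p <- s) DeltaB_l p.2 p.1 ->
  sliceL phi b x ** a = \sum_(p <- s) iC (Cl phi (x ** p.2)) *> p.1.
Proof.
move=> e; rewrite -fctr_mulL1 mulL1_DeltaB_r e !linear_sum; apply: eq_bigr => p _ /=.
by rewrite -(eqf _ (eqL_DeltaB_lM _ _ _)) phi_inv.
Qed.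
Lemma sliceE_strong c x b (s : seq (A * A)) :
  el_r c x = \sum_(p <- s) DeltaC_l p.1 p.2 ->
  c ** sliceE phi x b = \sum_(p <- s) p.1 <* iC (Cr phi (p.2 ** b)).
Proof.
move=> e; rewrite -kctr_mulR1 mulR1_DeltaC_r e !linear_sum; apply: eq_bigr => p _ /=.
by rewrite -(eqk _ (eqR_DeltaC_lM _ _ _)) kctr_phi_mul.
Qed.

Lemma bijection_factor (V W : lmodType K) (I : Type) (f g : I -> A -> A)
    (beta : A -> A -> V) (gamma : A -> A -> W) :
  induces_bijection f g beta -> balanced f g gamma ->
  exists G : {linear V -> W}, forall a b, G (beta a b) = gamma a b.
Proof.
move=> [lb [inv invK Kinv]] lg.
have inv_lin : linear inv := can2_linear (f := tlift lb) invK Kinv.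
have G_lin : linear (fun t => tlift lg (inv t)).
  by move=> k t t'; rewrite inv_lin linearP.
pose G : {linear V -> W} := HB.pack (fun t => tlift lg (inv t))
  (GRing.isLinear.Build K V W *:%R _ G_lin).
by exists G => a b; rewrite -(tliftE lb) /= [inv _]invK tliftE.
Qed.

(** * The antipode *)

(** The prescription is the antipode axiom u v_(1) S(v_(2)) = u S_B(epsB(v)); bijectivity of
    [lambda_T] turns it into a definition. *)
Lemma mulS_exists : exists S : {linear tens_r -> A},
  forall u v, S (DeltaC_l u v) = u <* iC (SB (epsB v)).
Proof.
apply: (bijection_factor (gamma := fun u v => u <* iC (epsSB v)) (lambda_T hD)).
split=> [*|*|*|*|y u v]; try by bilinear.
by rewrite /rC /lC lCmapE rCM.
Qed.

(* [mulS] sends c (x) a to c S(a), where S is the antipode. *)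
Definition mulS : {linear tens_r -> A} := sval (cid mulS_exists).
Lemma mulS_DeltaC_l u v : mulS (DeltaC_l u v) = u <* iC (SB (epsB v)).
Proof. exact: svalP (cid mulS_exists) u v. Qed.

(** Write a tensor t with [eqR t 0] as a sum of (p (x) 1)Delta_C(p'). Contraction by phi gives sum p
    phi_C(p'x) = 0 for all x, hence m = sum phi_C(zp)p' satisfies phi(mx) = 0 and vanishes. But
    phi(z [mulS t]) is mu_C(S_B(epsB(m))). *)
Lemma mulS_eqR t t' : eqR t t' -> mulS t = mulS t'.
Proof.
move=> h; apply/eqP; rewrite -subr_eq0 -linearB; apply/eqP.
have {h} : eqR (t - t') 0 by move=> a b; rewrite !linearB /= h subrr linear0.
move: (t - t') => {t'}t h0.
have [s es] := surj_seq (lambda_T hD) t.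
have slice x : \sum_(p <- s) p.1 <* iC (Cr phi (p.2 ** x)) = 0.
  transitivity (kctr (Cr phi) (DeltaC x t)).
    2: by rewrite (eqk _ (eqR_DeltaC _ h0)) !linear0.
  rewrite es !linear_sum; apply: eq_bigr => p _ /=.
  by rewrite -(eqk _ (eqR_DeltaC_lM _ _ _)) kctr_phi_mul.
apply: (faithful_injr phi_faithful) => z.
pose m := \sum_(p <- s) iC (Cr phi (z ** p.1)) *> p.2.
have -> : phi (z ** mulS t) = muC (epsSB m).
  rewrite es /m !linear_sum; apply: eq_bigr => p _ /=.
  by rewrite mulS_DeltaC_l -rmA (adCr muCf) -[RHS]/(muC (epsSB _)) lCmapE.
suff -> : m = 0 by rewrite !linear0.
apply: (faithful_injl phi_faithful) => x.
transitivity (phi (z ** \sum_(p <- s) p.1 <* iC (Cr phi (p.2 ** x)))).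
  2: by rewrite slice !linear0.
rewrite numul_suml !linear_sum; apply: eq_bigr => p _ /=.
by rewrite -lmA (adCl muCf) -rmA (adCr muCf) phiC.
Qed.

Fact mulS_linr c : linear (fun a => mulS (el_r c a)).
Proof. by move=> k a b; rewrite el_rDr el_rZr linearP. Qed.
Fact mulS_linl a : linear (fun c => mulS (el_r c a)).
Proof. by move=> k c d; rewrite el_rDl el_rZl linearP. Qed.
Lemma mulS_0l a : mulS (el_r 0 a) = 0.
Proof. by have [] := linear_mapE (mulS_linl a). Qed.
Lemma mulS_Bl c d a : mulS (el_r (c - d) a) = mulS (el_r c a) - mulS (el_r d a).
Proof. by rewrite -scaleN1r el_rDl el_rZl linearD linearZ /= scaleN1r. Qed.

Lemma mulS_ractlB x t : mulS (ractlB x t) = mulS t <* iC (SB x).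
Proof.
elim/(DeltaC_l_ind hD): t => [|t t' ht ht'|u v]; rewrite ?linear0 //.
  by rewrite !linearD /= ht ht'.
rewrite -(mulS_eqR (eqR_DeltaC_l_lB _ _ _)) !mulS_DeltaC_l.
by rewrite (epsB_lB hepsB) SB_anti rCM.
Qed.
Lemma mulS_DeltaC v t : mulS (DeltaC v t) = mulS (ractC (SB (epsB v)) t).
Proof.
elim/(DeltaC_l_ind hD): t => [|t t' ht ht'|u w]; rewrite ?linear0 //.
  by rewrite !linearD /= ht ht'.
rewrite -(mulS_eqR (eqR_DeltaC_lM _ _ _)) -(mulS_eqR (eqR_DeltaC_l_rC _ _ _)).
by rewrite !mulS_DeltaC_l (epsB_mulS hepsB).
Qed.
(** Anti-multiplicativity c S(ab) = c S(b) S(a), stated while S exists only through [mulS]. On (u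
    (x) 1)Delta_C(v) it reduces to [mulS_DeltaC]. *)
Lemma mulS_mulR2 a t : mulS (mulR2 a t) = mulS (el_r (mulS t) a).
Proof.
elim/(DeltaC_l_ind hD): t => [|t t' ht ht'|u v].
- by rewrite !linear0 mulS_0l.
- by rewrite !linearD /= ht ht' el_rDl linearD.
by rewrite mulR2_DeltaC_l mulS_DeltaC ractCE mulS_DeltaC_l.
Qed.
Lemma mulS_lB c x a : mulS (el_r c (iB x *> a)) = mulS (el_r c a) <* iC (SB x).
Proof. by rewrite -mulS_ractlB ractlBE. Qed.
Lemma mulS_rC c y a : mulS (el_r c (a <* iC y)) = mulS (el_r (c <* iB (SC y)) a).
Proof. by rewrite el_r_bal. Qed.
Lemma mulSM c a b : mulS (el_r c (a ** b)) = mulS (el_r (mulS (el_r c b)) a).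
Proof. by rewrite -mulS_mulR2 mulR2E. Qed.

Fact mulS_mul_linl c b : linear (fun a => mulS (el_r c a) ** b).
Proof. by move=> k a a'; rewrite mulS_linr; bilinear. Qed.

(** The other antipode axiom, c S(p_(1)) p_(2) q = c S_C(epsC(p)) q. Both sides are linear in c (x)
    p, and on (u (x) 1)Delta_C(v) coassociativity and the definition of [mulS] reduce them to
    uvq. *)
Lemma mulS_counit c p q :
  tmap (fun a b => mulS (el_r c a) ** b) (DeltaB_r p q) =
  (c <* iB (SC (epsC p))) ** q.
Proof.
pose psi u v z := mulS (el_r u v) ** z.
have psi_lin u v : linear (psi u v) := numul_is_linear _.
have bal z : balanced (@rSC K Q) (@rC K Q) (fun u v => psi u v z).
  by split=> *; rewrite /psi ?el_rDl ?el_rDr ?el_rZl ?el_rZr;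
    rewrite ?mulS_rC //; bilinear.
have bal' x u v z : psi u (iB x *> v) z = psi u v (iC (SB x) *> z).
  by rewrite /psi mulS_lB lrA.
have [_ b2 _] := DeltaCB_trilinear psi_lin c p q bal bal'.
transitivity (tlift b2 (el_r c p)); first by rewrite tliftE.
rewrite -(kctrE epsCr).
elim/(DeltaC_l_ind hD): (el_r c p) => [|t t' ht ht'|u v].
- by rewrite !linear0 numul0a.
- by rewrite !linearD /= ht ht' numulDl.
have [_ _ coassoc] := DeltaCB_trilinear psi_lin u v q bal bal'.
apply: (etrans (esym coassoc)).
rewrite counit_Cl -numulA -(counit_Br v q) /gctr /tlift.
rewrite (tmap_lin _ _ (numul_is_linear u)); apply: tmap_ext => d e.
rewrite lrA -mulS_DeltaC_l -[tmap _ _]/(tlift (bal e) _).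
elim/tens_r_ind: (DeltaC_l u d) => [|t t' ht ht'|u' v'].
- by rewrite !linear0 numul0a.
- by rewrite !linearD /= ht ht' numulDl.
by rewrite tliftE.
Qed.

(** The first strong invariance relation. With c (x) x expanded as a sum of (u (x) 1)Delta_C(v),
    both sides become the sum of u phi_C(vb). *)
Lemma mulS_sliceL c b x : mulS (el_r c (sliceL phi b x)) = c ** sliceE phi x b.
Proof.
pose psi u v z := mulS (el_r u v) <* iC (Cl phi z).
have psi_lin u v : linear (psi u v) by move=> k z z'; rewrite /psi; bilinear.
have bal z : balanced (@rSC K Q) (@rC K Q) (fun u v => psi u v z).
  by split=> *; rewrite /psi ?el_rDl ?el_rDr ?el_rZl ?el_rZr;
    rewrite ?mulS_rC //; bilinear.
have bal' x' u v z : psi u (iB x' *> v) z = psi u v (iC (SB x') *> z).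
  by rewrite /psi mulS_lB lCmapE rCM.
have [_ b2 _] := DeltaCB_trilinear psi_lin c x b bal bal'.
have -> : mulS (el_r c (sliceL phi b x)) = tlift b2 (el_r c x).
  rewrite tliftE /sliceL /fctr /tlift (tmap_lin _ _ (mulS_linr c)).
  by apply: tmap_ext => d e; rewrite mulS_lB SBinvK.
have [s es] := surj_seq (lambda_T hD) (el_r c x).
rewrite (sliceE_strong _ es) es linear_sum; apply: eq_bigr => -[u v] _ /=.
have [_ _ coassoc] := DeltaCB_trilinear psi_lin u v b bal bal'.
apply: (etrans (esym coassoc)).
have lin : linear (fun a => u <* iC (Cl phi a)) by move=> k a a'; bilinear.
rewrite -[fac__C _ _]/(Cr phi (v ** b)) -phiC -(counit_Br v b).
rewrite /gctr /tlift (tmap_lin _ _ lin).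
apply: tmap_ext => d e; rewrite lCmapE rCM -mulS_DeltaC_l.
rewrite -[tmap _ _]/(tlift (bal e) _).
elim/tens_r_ind: (DeltaC_l u d) => [|t t' ht ht'|u' v']; rewrite ?linear0 //.
  by rewrite !linearD /= ht ht'.
by rewrite tliftE.
Qed.

(** Fullness of phi concerns B; this substitutes for the surjectivity of phi_C until [phiC_onto].
    The hypothesis forces phi_B(mz) = 0 for all z, so phi(xmz) = 0 and xm = 0 for x in B, and AB = A
    concludes. *)
Lemma phiC_annihilator_l m : (forall e, iB (SB' (Cl phi e)) *> m = 0) -> m = 0.
Proof.
move=> h; apply: (numul_injr ndA).
apply: rB_ind => [|a b ha hb|x a]; rewrite ?numul0a //.
  by rewrite numulDl ha hb addr0.
suff xm : iB x *> m = 0 by rewrite -lrA xm linear0.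
apply: (faithful_injl phi_faithful) => z.
rewrite -lmA (adBl muBf).
suff -> : Bl phi (m ** z) = 0 by rewrite linear0 linear0.
apply: (can_inj (@SBK K Q)); rewrite linear0.
apply: lC_inj => e; rewrite linear0 la0.
apply: (faithful_injl phi_faithful) => e'.
rewrite -lmA (adCl muCf) (muC_SBl mu_SB) -(adBl muBf) lmA h.
by rewrite numul0a linear0.
Qed.

Lemma phiC_annihilator_r a : (forall e, a <* iB (SC (Cr phi e)) = 0) -> a = 0.
Proof.
move=> h; apply: (numul_injl ndA).
apply: lB_ind => [|b c hb hc|x b]; rewrite ?linear0 //.
  by rewrite linearD /= hb hc addr0.
suff ax : a <* iB x = 0 by rewrite lrA ax numul0a.
apply: (faithful_injr phi_faithful) => z.
rewrite -rmA (adBr muBf).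
suff -> : Br phi (z ** a) = 0 by rewrite numul0a linear0.
apply: (can_inj (@SCinvK K Q)); rewrite !linear0.
apply: rC_inj => e; rewrite linear0 ra0.
apply: (faithful_injr phi_faithful) => e'.
rewrite -rmA (adCr muCf) -(muB_SCr mu_SC) -(adBr muBf) rmA h.
by rewrite !linear0.
Qed.

(** By strong invariance m kills all slices b_(1) phi(x b_(2)), hence all contractions d
    S_C(phi_C(e)); [phiC_annihilator_r] then applies to each m d. *)
Lemma mulS_inj m : (forall b, mulS (el_r m b) = 0) -> m = 0.
Proof.
move=> h.
have mk t : m ** kctr (Cr phi) t = 0.
  elim/(DeltaC_r_ind hD): t => [|t t' ht ht'|b x]; rewrite ?linear0 //.
    by rewrite !linearD /= ht ht' addr0.
  by rewrite -[kctr _ _]/(sliceE phi x b) -mulS_sliceL h.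
apply: (numul_injl ndA) => d; apply: phiC_annihilator_r => e.
by rewrite rmA -kctrE mk.
Qed.
(** By anti-multiplicativity, both sides times S(b) give c S(bya), so [mulS_inj] identifies them. *)
Lemma mulS_lC c y a : mulS (el_r c (iC y *> a)) = mulS (el_r c a) <* iB (SC y).
Proof.
apply/eqP; rewrite -subr_eq0; apply/eqP; apply: mulS_inj => b.
rewrite mulS_Bl -mulS_rC -!mulSM.
by rewrite lrA subrr.
Qed.

(** * The second strong invariance relation *)

Section SliceM.
Variable w : adfun.
Local Notation M := (sliceM w).

Lemma sliceM_lB b x a : M b (iB x *> a) = iB x *> M b a.
Proof. by rewrite /sliceM (eqh _ (eqR_DeltaC_l_lB _ _ _)) hctr_ractlB. Qed.
Lemma sliceM_rSC b y a : M (b <* iB (SC y)) a = iC y *> M b a.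
Proof. by rewrite /sliceM (eqh _ (eqR_DeltaC_l_lC _ _ _)) hctr_ractlC. Qed.

Fact sliceM_mul_lin v x : linear (fun u => v ** M u x).
Proof. by move=> k u u'; rewrite sliceM_linl linearP. Qed.

Lemma sliceM_mul b a x :
  M b (a ** x) = tmap (fun u v => v ** M u x) (DeltaC_l b a).
Proof.
have bal : balanced (@rSC K Q) (@rC K Q) (fun u v => v ** M u x).
  have linM v := linear_mapE (sliceM_mul_lin v x).
  split=> [u u' v|u v v'|k u v|k u v|y u v]; try by bilinear.
  - by have [_ ->] := linM v.
  - by rewrite (linear_mapZ (sliceM_mul_lin v x)).
  by rewrite /rSC /rC sliceM_rSC lrA.
rewrite /sliceM (eqh _ (eqR_DeltaC_lM _ _ _)) -[RHS]/(tlift bal _).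
elim/tens_r_ind: (DeltaC_l b a) => [|t t' ht ht'|u v]; rewrite ?linear0 //.
  by rewrite !linearD /= ht ht'.
by rewrite -mulR2_DeltaC_l hctr_mulR2 tliftE.
Qed.

Fact mulS_sliceM_lin c b e : linear (fun a => mulS (el_r c (M b a)) ** e).
Proof. by move=> k a a'; rewrite sliceM_lin mulS_mul_linl. Qed.

Fact mulS_sliceM_bal c b : balanced (@lB K Q) (@lSB K Q)
  (fun a e => mulS (el_r c (M b a)) ** e).
Proof.
have lin e := linear_mapE (mulS_sliceM_lin c b e).
split=> [a a' e|a e e'|k a e|k a e|x a e]; try by bilinear.
- by have [_ ->] := lin e.
- by rewrite (linear_mapZ (mulS_sliceM_lin c b e)).
by rewrite /lB /lSB sliceM_lB mulS_lB lrA.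
Qed.

(** In Sweedler notation, c w(b p_(1)) S(p_(2)) p_(3) q = c w(bp) q, with w replaced by its factor:
    coassociativity followed by [mulS_counit] and the counit. *)
Lemma mulS_sliceM_counit c b p q :
  tmap (fun a e => mulS (el_r c (M b a)) ** e) (DeltaB_r p q) =
  (c <* iB (Br w (b ** p))) ** q.
Proof.
pose psi u v z := mulS (el_r (c <* iB (Br w u)) v) ** z.
have psi_lin u v : linear (psi u v) := numul_is_linear _.
have linB v : linear (fun u => mulS (el_r (c <* iB (Br w u)) v)).
  move=> k u u'; rewrite -mulS_linl; congr (mulS (el_r _ v)); by bilinear.
have bal z : balanced (@rSC K Q) (@rC K Q) (fun u v => psi u v z).
  split=> *; rewrite /psi ?el_rDr ?el_rZr; try by bilinear.
  - by rewrite (linear_mapE (linB _)).2 numulDl.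
  - by rewrite (linear_mapZ (linB _)) numulZl.
  by rewrite /rSC /rC rBmapE rBM mulS_rC.
have bal' x u v z : psi u (iB x *> v) z = psi u v (iC (SB x) *> z).
  by rewrite /psi mulS_lB lrA.
have [_ _ coassoc] := DeltaCB_trilinear psi_lin b p q bal bal'.
transitivity (tmap (fun d e => tmap (fun u v => psi u v e) (DeltaC_l b d))
    (DeltaB_r p q)).
  apply: tmap_ext => d e; rewrite -[RHS]/(tlift (bal e) _) /sliceM.
  elim/tens_r_ind: (DeltaC_l b d) => [|t t' ht ht'|u v].
  - by rewrite !linear0 (linear_mapE (mulS_mul_linl c e)).1.
  - by rewrite !linearD (linear_mapE (mulS_mul_linl c e)).2 ht ht'.
  by rewrite tliftE hctrE mulS_rC SCinvK.
rewrite coassoc; have lin : linear (fun a => (c <* iB (Br w a)) ** q).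
  by move=> k a a'; bilinear.
rewrite -(counit_Cl b p) /kctr /tlift (tmap_lin _ _ lin); apply: tmap_ext => d e.
by rewrite /psi mulS_counit rBmapE rBM.
Qed.

Lemma mulS_sliceM_mul c b a x d :
  tmap (fun a e => mulS (el_r c (M b a)) ** e) (DeltaB a (el_l x d)) =
  mulS (el_r c (M (b ** a) x)) ** d.
Proof.
pose psi u v z := mulS (el_r (mulS (el_r c (M u x))) v) ** z.
have psi_lin u v : linear (psi u v) := numul_is_linear _.
have linM v : linear (fun u => mulS (el_r (mulS (el_r c (M u x))) v)).
  by move=> k u u'; rewrite sliceM_linl mulS_linr mulS_linl.
have bal z : balanced (@rSC K Q) (@rC K Q) (fun u v => psi u v z).
  split=> [u u' v|u v v'|k u v|k u v|y u v]; rewrite /psi ?el_rDr ?el_rZr;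
    try by bilinear.
  - by have [_ ->] := linear_mapE (linM v); rewrite numulDl.
  - by rewrite (linear_mapZ (linM v)) numulZl.
  by rewrite /rSC /rC sliceM_rSC mulS_lC mulS_rC.
have bal' x' u v z : psi u (iB x' *> v) z = psi u v (iC (SB x') *> z).
  by rewrite /psi mulS_lB lrA.
have [_ _ coassoc] := DeltaCB_trilinear psi_lin b a d bal bal'.
transitivity (tmap (fun d' e => tmap (fun u v => psi u v e) (DeltaC_l b d'))
    (DeltaB_r a d)).
  have psiE s e : tmap (fun u v => psi u v e) (DeltaC_l b s) =
      mulS (el_r c (M b (s ** x))) ** e.
    rewrite sliceM_mul (tmap_lin _ _ (mulS_mul_linl c e)).
    by apply: tmap_ext => u v; rewrite mulSM.
  rewrite (tmap_ext _ psiE) -mulL1_DeltaB_r.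
  have lin e : linear (fun s => mulS (el_r c (M b (s ** x))) ** e).
    by move=> k s s'; rewrite numulDl numulZl (mulS_sliceM_lin c b e).
  have bal2 : balanced (@lB K Q) (@lSB K Q)
      (fun s e => mulS (el_r c (M b (s ** x))) ** e).
    split=> [s s' e|s e e'|k s e|k s e|x' s e]; try by bilinear.
    - by have [_ ->] := linear_mapE (lin e).
    - by rewrite (linear_mapZ (lin e)).
    by rewrite /lB /lSB -lmA sliceM_lB mulS_lB lrA.
  rewrite -[LHS]/(tlift (mulS_sliceM_bal c b) _) -[RHS]/(tlift bal2 _).
  elim/tens_l_ind: (DeltaB_r a d) => [|t t' ht ht'|s e]; rewrite ?linear0 //.
    by rewrite !linearD /= ht ht'.
  by rewrite mulL1E !tliftE.
rewrite coassoc; have lin : linear (fun u => mulS (el_r c (M u x)) ** d).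
  by move=> k u u'; rewrite sliceM_linl mulS_mul_linl.
rewrite -(counit_Cl b a) /kctr /tlift (tmap_lin _ _ lin); apply: tmap_ext => u e.
by rewrite /psi mulS_counit sliceM_rSC mulS_lC.
Qed.

Hypothesis w_eq0 : forall m, (forall x, w (x ** m) = 0) -> w m = 0.

Lemma Br_sum_eq0 (s : seq (A * A)) :
  (forall a, \sum_(p <- s) iB (Br w (a ** p.1)) *> p.2 = 0) ->
  \sum_(p <- s) iB (Br w p.1) *> p.2 = 0.
Proof.
move=> h; apply: (faithful_injl phi_faithful) => z.
transitivity (w (\sum_(p <- s) p.1 <* iB (Bl phi (p.2 ** z)))).
  rewrite numul_suml !linear_sum; apply: eq_bigr => p _ /=.
  by rewrite -lmA (adBl muBf) (adBr muBf).
apply: w_eq0 => a; transitivity (phi ((\sum_(p <- s)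
    iB (Br w (a ** p.1)) *> p.2) ** z)); last by rewrite h numul0a linear0.
rewrite numul_suml !linear_sum; apply: eq_bigr => p _ /=.
by rewrite -lmA -rmA (adBl muBf) (adBr muBf).
Qed.

(** [G] plays the role of the contraction w (x) id, with which it agrees when w is right invariant.
    The general form also serves w = phi, where it shows that S takes values in A. *)
Lemma mulS_sliceM (G : {linear tens_l -> A}) :
  (forall p q, G (DeltaB_r p q) = iB (Br w p) *> q) ->
  forall c b x, mulS (el_r c (M b x)) = c ** G (DeltaB_l b x).
Proof.
move=> GE.
pose H c b := tlift (mulS_sliceM_bal c b).
have H_sum c b (s : seq (A * A)) : H c b (\sum_(p <- s) DeltaB_r p.1 p.2) =
    c ** \sum_(p <- s) iB (Br w (b ** p.1)) *> p.2.
  rewrite /H !linear_sum; apply: eq_bigr => p _ /=.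
  by rewrite [LHS]mulS_sliceM_counit -lrA.
have H_el c b x d : H c b (el_l x d) = mulS (el_r c (M b x)) ** d.
  exact: tliftE.
have H_mulL2 c b d t : H c b (mulL2 d t) = H c b t ** d.
  move: H_el; rewrite /H => H_el.
  elim/tens_l_ind: t => [|t t' ht ht'|x e]; rewrite ?linear0 ?numul0a //.
    by rewrite !linearD /= numulDl ht ht'.
  by rewrite mulL2E !H_el numulA.
move=> c b x; apply: (numul_eql ndA) => d.
have [s es] := surj_seq (T_rho hD) (DeltaB_l b x).
have [s' es'] := surj_seq (T_rho hD) (el_l x d).
rewrite -H_el es' H_sum -numulA; congr (_ ** _); rewrite es linear_sum numul_suml.
apply/eqP; rewrite -subr_eq0 -sumrN; apply/eqP.
(* The difference of the two sides, times d, as a single sum of w_B(p)p'. *)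
pose s1 := [seq (b ** p.1, p.2) | p <- s'] ++ [seq (- p.1, p.2 ** d) | p <- s].
transitivity (\sum_(p <- s1) iB (Br w p.1) *> p.2).
  rewrite big_cat !big_map; congr (_ + _); apply: eq_bigr => p _ //=.
  by rewrite GE -lmA -[fac__B _ (- _)]/(Br w (- p.1)) !linearN laN.
(* With a inserted, both halves can be computed by [H_sum], and they agree by [mulS_sliceM_mul]. *)
apply: Br_sum_eq0 => a; rewrite big_cat !big_map /=.
apply: (numul_eqr ndA) => c'; rewrite linear0 linearD /=.
have -> : \sum_(p <- s') iB (Br w (a ** (b ** p.1))) *> p.2 =
    \sum_(p <- s') iB (Br w ((a ** b) ** p.1)) *> p.2.
  by apply: eq_bigr => p _; rewrite numulA.
rewrite -H_sum -es' H_el -mulS_sliceM_mul -[tmap _ _]/(H c' a _).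
rewrite -mulL2_DeltaB_l H_mulL2 es H_sum -numulA numul_suml -linearD -big_split.
rewrite big1 ?linear0 // => p _ /=.
by rewrite -[fac__B _ (a ** - _)]/(Br w (a ** - p.1)) !linearN laN -lmA subrr.
Qed.

End SliceM.

Lemma phi_eq0 m : (forall x, phi (x ** m) = 0) -> phi m = 0.
Proof. by move=> h; rewrite (faithful_injr phi_faithful h) linear0. Qed.

Lemma Br_factor (w : adfun) : exists G : {linear tens_l -> A},
  forall p q, G (DeltaB_r p q) = iB (Br w p) *> q.
Proof.
apply: (bijection_factor (T_rho hD)).
split=> [*|*|*|*|x p q]; try by bilinear.
by rewrite /rB /lB rBmapE lBM.
Qed.

(** As A = AC and phi_B is onto, A is spanned by contractions of the first leg by phi. By [lambda_T]
    these are sums of slices [sliceM phi b x], whose antipode is given by [mulS_sliceM]. *)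
Lemma antipode_exists a : exists s, forall c, mulS (el_r c a) = c ** s.
Proof.
pose P a := exists s, forall c, mulS (el_r c a) = c ** s.
have P0 : P 0.
  by exists 0 => c; rewrite (linear_mapE (mulS_linr c)).1 linear0.
have PD b c : P b -> P c -> P (b + c).
  move=> [s hs] [s' hs']; exists (s + s') => d.
  by rewrite (linear_mapE (mulS_linr d)).2 hs hs' linearD.
move: a; apply: (rC_ind P0 PD) => y v.
have [u yE] := phiBr_onto (SC y).
suff : forall t, P (hctr (Br phi) t).
  by move=> /(_ (el_r u v)); rewrite hctrE yE SCK.
elim/(DeltaC_l_ind hD) => [|t t' ht ht'|b x]; first by rewrite linear0.
  by rewrite linearD; apply: PD.
have [G GE] := Br_factor phi.
by exists (G (DeltaB_l b x)) => c; rewrite -(mulS_sliceM phi_eq0 GE).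
Qed.

Definition antipode a : A := sval (cid (antipode_exists a)).
Local Notation S := antipode.
Lemma antipodeE c a : mulS (el_r c a) = c ** S a.
Proof. exact: svalP (cid (antipode_exists a)) c. Qed.
Fact antipode_linear : linear S.
Proof.
move=> k a b; apply: (numul_eqr ndA) => c.
by rewrite -antipodeE mulS_linr !antipodeE linearP.
Qed.
HB.instance Definition _ := GRing.isLinear.Build K A A *:%R S antipode_linear.

Lemma antipode_sliceL b x : S (sliceL phi b x) = sliceE phi x b.
Proof. by apply: (numul_eqr ndA) => c; rewrite -antipodeE mulS_sliceL. Qed.
Lemma antipode_lB x a : S (iB x *> a) = S a <* iC (SB x).
Proof. by apply: (numul_eqr ndA) => c; rewrite -antipodeE mulS_lB antipodeE rmA. Qed.
Lemma antipode_lC y a : S (iC y *> a) = S a <* iB (SC y).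
Proof. by apply: (numul_eqr ndA) => c; rewrite -antipodeE mulS_lC antipodeE rmA. Qed.
Lemma antipode_rC y a : S (a <* iC y) = iB (SC y) *> S a.
Proof. by apply: (numul_eqr ndA) => c; rewrite -antipodeE mulS_rC antipodeE lrA. Qed.
Lemma antipodeM a b : S (a ** b) = S b ** S a.
Proof.
by apply: (numul_eqr ndA) => c; rewrite -antipodeE mulSM !antipodeE numulA.
Qed.

(** The same argument read backwards: A is spanned by the phi_B(p)q = G(Delta_B(p)(1 (x) q)), and by
    [T_lambda] these are sums of values of S on slices. *)
Lemma antipode_onto a : exists b, S b = a.
Proof.
have P0 : exists b, S b = 0 by exists 0; rewrite linear0.
have PD a1 a2 : (exists b, S b = a1) -> (exists b, S b = a2) ->
    exists b, S b = a1 + a2.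
  by move=> [b <-] [b' <-]; exists (b + b'); rewrite linearD.
move: a; apply: (lB_ind P0 PD) => x q.
have [p <-] := phiBr_onto x; have [G GE] := Br_factor phi.
rewrite -GE; move: (DeltaB_r p q).
elim/(DeltaB_l_ind hD) => [|t t' ht ht'|b u]; first by rewrite linear0.
  by rewrite linearD; apply: PD.
exists (sliceM phi u b); apply: (numul_eqr ndA) => c.
by rewrite -antipodeE (mulS_sliceM phi_eq0 GE).
Qed.
Lemma antipode_rB x a : S (a <* iB x) = iC (SB x) *> S a.
Proof.
apply: (numul_eqr ndA) => c; have [b <-] := antipode_onto c.
by rewrite -antipodeM -lrA antipodeM antipode_lB lrA.
Qed.

Section FactorsS.
Variable w : adfun.
Fact compS_scalar : scalar (fun a => w (S a)).
Proof. by move=> k a b; rewrite !linearP. Qed.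
Definition compS := fun a => w (S a).
HB.instance Definition _ := GRing.isLinear.Build K A K *%R compS compS_scalar.
Fact compS_adapted : adapted muB muC compS (Factors
  (fun a => SB' (Cr w (S a))) (fun a => SB' (Cl w (S a)))
  (fun a => SC' (Br w (S a))) (fun a => SC' (Bl w (S a)))).
Proof.
split=> [x a|x a|y a|y a]; rewrite /compS.
- by rewrite -[LHS]/(w (S _)) antipode_lB (adCr muCf) (muC_SBr mu_SB).
- by rewrite -[LHS]/(w (S _)) antipode_rB (adCl muCf) (muC_SBl mu_SB).
- by rewrite -[LHS]/(w (S _)) antipode_lC (adBr muBf) (muB_SCr mu_SC).
- by rewrite -[LHS]/(w (S _)) antipode_rC (adBl muBf) (muB_SCl mu_SC).
Qed.
Definition adS : adfun := Adfun compS_adapted.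
End FactorsS.

(** * The functional phi o S is a right integral *)

Local Notation psi0 := (adS phi).

Fact scale_right_balanced (F : lCmap) q : balanced (@lB K Q) (@lSB K Q)
  (fun u v => el_l u (iC (F v) *> q)).
Proof.
split=> [*|*|*|*|x u v]; rewrite ?el_lDl ?el_lZl -?el_lDr -?el_lZr //;
  try by bilinear.
by rewrite /lB /lSB lCmapE lCM el_l_bal.
Qed.

Definition scale_right F q : tens_l -> tens_l := tlift (scale_right_balanced F q).
HB.instance Definition _ F q :=
  GRing.Linear.copy (scale_right F q) (tlift (scale_right_balanced F q)).
Lemma scale_rightE F q u v : scale_right F q (el_l u v) = el_l u (iC (F v) *> q).
Proof. exact: tliftE. Qed.
Lemma mulL_scale_right F q f c t :
  mulL f c (scale_right F q t) = scale_right F (q ** c) (mulL1 f t).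
Proof.
elim/tens_l_ind: t => [|t t' ht ht'|u v]; rewrite ?linear0 //.
  by rewrite !linearD /= ht ht'.
by rewrite mulL1E !scale_rightE mulLE lmA.
Qed.
Lemma scale_right_mulL2 F q p t :
  scale_right F q (mulL2 p t) = scale_right (lCmap_mul F p) q t.
Proof.
elim/tens_l_ind: t => [|t t' ht ht'|u v]; rewrite ?linear0 //.
  by rewrite !linearD /= ht ht'.
by rewrite mulL2E !scale_rightE.
Qed.

(** In Sweedler notation the left side is x_(1) (x) x_(2) phi(x_(3) d) b; coassociativity exposes
    the slice of x_(2), and [sliceL_strong] evaluates it. *)
Lemma DeltaB_r_sliceL b d x (s : seq (A * A)) :
  el_l b d = \sum_(p <- s) DeltaB_l p.2 p.1 ->
  eqL (DeltaB_r (sliceL phi d x) b)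
    (\sum_(p <- s) scale_right (Cl phi) p.1 (DeltaB_r x p.2)).
Proof.
move=> es f c; rewrite mulL_DeltaB_r.
pose psi u v w := el_l u ((iB (SB' (Cl phi w)) *> v) ** (b ** c)).
have psi_lin u v : linear (psi u v).
  by move=> k z z'; rewrite /psi -el_lZr -el_lDr; congr (el_l u _); bilinear.
have bal z : balanced (@lB K Q) (@lSB K Q) (fun u v => psi u v z).
  split=> [*|*|*|*|x' u v]; rewrite /psi ?el_lDl ?el_lZl -?el_lDr -?el_lZr //;
    try by bilinear.
  by rewrite /lB /lSB el_l_bal lBC lmA.
have bal' x' u v z : psi u (iB x' *> v) z = psi u v (iC (SB x') *> z).
  by rewrite /psi lCmapE SB'_anti SBK lBM.
have [_ _ coassoc] := DeltaB_trilinear psi_lin f x d bal bal'.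
have lin : linear (fun a => DeltaB a (el_l f (b ** c))).
  by move=> k a a'; rewrite DeltaB_linear.
rewrite /sliceL /fctr /tlift (tmap_lin _ _ lin).
transitivity (tmap (fun d e => tmap (fun u v => psi u v e) (DeltaB_l d f))
  (DeltaB_r x d)).
  apply: tmap_ext => u v; rewrite DeltaB_lact -mulL2_DeltaB_l.
  rewrite -[RHS]/(tlift (bal v) _).
  elim/tens_l_ind: (DeltaB_l u f) => [|t t' ht ht'|u' v']; rewrite ?linear0 //.
    by rewrite !linearD /= ht ht'.
  by rewrite mulL2E lactBE tliftE /psi lmA.
rewrite coassoc linear_sum /=.
have -> : tmap (fun d0 e => tmap (fun p q => psi d0 p q) (DeltaB_r e d))
    (DeltaB_l x f) =
  tmap (fun u v => el_l u ((sliceL phi d v ** b) ** c)) (DeltaB_l x f).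
  apply: tmap_ext => u v; rewrite -numulA /sliceL /fctr /tlift.
  have lin' : linear (fun a => el_l u (a ** (b ** c))).
    by move=> k a a'; rewrite -el_lZr -el_lDr; congr (el_l u _); bilinear.
  by rewrite (tmap_lin _ _ lin').
have step p : mulL f c (scale_right (Cl phi) p.1 (DeltaB_r x p.2)) =
    tmap (fun u v => el_l u ((iC (Cl phi (v ** p.2)) *> p.1) ** c)) (DeltaB_l x f).
  rewrite mulL_scale_right mulL1_DeltaB_r -mulL2_DeltaB_l scale_right_mulL2.
  by apply: tmap_ext => u v; rewrite lmA.
rewrite (eq_bigr _ (fun p _ => step p)).
rewrite /tmap exchange_big /=; apply: eq_bigr => -[u v] _ /=.
rewrite (sliceL_strong _ es) numul_suml.
elim: (s) => [|p t ih].
  by rewrite !big_nil -[in LHS](scale0r 0) el_lZr scale0r.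
by rewrite !big_cons -ih el_lDr.
Qed.

Lemma gctr_scale_right q t :
  gctr (Bl psi0) (scale_right (Cl phi) q t) =
  iC (Cr phi (S (fctr (Cl phi) t))) *> q.
Proof.
elim/tens_l_ind: t => [|t t' ht ht'|u v]; rewrite ?linear0 //.
  by rewrite !linearD; congr (_ + _).
by rewrite scale_rightE gctrE fctrE antipode_lB SBinvK rCmapE lCM /= SBinvK.
Qed.

(* It suffices to compare the two sides on the slices [sliceL phi d x], on which
   the antipode is known: they span phi_C(A) A up to S_B, and phi_C(A) has no
   annihilator. *)
Lemma psi0_right_invariant : right_invariant psi0.
Proof.
pose F b a := gctr (Bl psi0) (DeltaB_r a b).
pose G b a := iB (Bl psi0 a) *> b.
have F_lin b : linear (F b).
  by move=> k a a'; rewrite /F (DeltaB_r_linl hD b) linearP.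
have G_lin b : linear (G b) by move=> k a a'; rewrite /G; bilinear.
have F_lB b x a : F b (iB x *> a) = iB x *> F b a.
  by rewrite /F (eqg _ (eqL_DeltaB_r_lB _ _ _)) gctr_lactB.
have G_lB b x a : G b (iB x *> a) = iB x *> G b a.
  by rewrite /G lBmapE lBM.
have sliceL_case b d x : F b (sliceL phi d x) = G b (sliceL phi d x).
  have [s es] := surj_seq (T_lambda hD) (el_l b d).
  rewrite /F (eqg _ (DeltaB_r_sliceL _ es)) linear_sum /=.
  have E p : gctr (Bl psi0) (scale_right (Cl phi) p.1 (DeltaB_r x p.2)) =
      fctr (sliceEC phi (Cl phi) x) (DeltaB_l p.2 p.1).
    by rewrite gctr_scale_right -[fctr _ _]/(sliceL phi p.2 x) antipode_sliceL -phiC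
      -phi_inv fctr_sliceE.
  rewrite (eq_bigr _ (fun p _ => E p)) -linear_sum -es [LHS]fctrE /=.
  by rewrite /G /= antipode_sliceL -[fac__C _ _]/(Cr phi _) -phiC.
move=> a b; apply/eqP; rewrite -subr_eq0; apply/eqP.
apply: phiC_annihilator_l => e.
rewrite linearB -[gctr _ _]/(F b a) -[iB (Bl _ _) *> b]/(G b a) /=.
rewrite -[fac_C_ _ _]/(Cl phi e) -F_lB -G_lB -fctrE.
move: (el_l a e).
elim/(DeltaB_r_ind hD) => [|t t' ht ht'|x d].
- by rewrite linear0 (linear_mapE (F_lin b)).1 (linear_mapE (G_lin b)).1 subrr.
- rewrite linearD (linear_mapE (F_lin b)).2 (linear_mapE (G_lin b)).2.
  by rewrite opprD addrACA ht ht' addr0.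
by rewrite -[fctr _ _]/(sliceL phi d x) sliceL_case subrr.
Qed.

Lemma psi0_Cl_onto y : exists a, Cl psi0 a = y.
Proof.
have [b hb] := phiBr_onto (SC y); have [a ha] := antipode_onto b.
by exists a; rewrite /= ha -[fac__B _ _]/(Br phi _) hb SCK.
Qed.
Lemma psi0_Cr_onto y : exists a, Cr psi0 a = y.
Proof.
have [b hb] := phiB_onto (SC y); have [a ha] := antipode_onto b.
by exists a; rewrite /= ha -[fac_B_ _ _]/(Bl phi _) hb SCK.
Qed.

(** Since phi o S is full, every a' is the density of some a, whence phi(na') = phi(S(na)) =
    phi(S(a)S(n)) = 0. *)
Lemma antipode_inj n : S n = 0 -> n = 0.
Proof.
move=> n0; apply: (faithful_injl phi_faithful) => a'.
have [a [_ <-]] := density_onto psi0_right_invariant psi0_Cl_onto a'.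
by rewrite -[LHS]/(phi (S _)) antipodeM n0 !linear0.
Qed.

(** * The inverse of the antipode *)

Definition antipode_inv a : A := sval (cid (antipode_onto a)).
Local Notation T := antipode_inv.
Lemma antipode_invK a : S (T a) = a.
Proof. exact: svalP (cid (antipode_onto a)). Qed.
Lemma antipode_inv_eq a b : S b = a -> T a = b.
Proof.
move=> <-; apply/eqP; rewrite -subr_eq0; apply/eqP/antipode_inj.
by rewrite linearB /= antipode_invK subrr.
Qed.
Fact antipode_inv_linear : linear T.
Proof.
by move=> k a b; apply: antipode_inv_eq; rewrite linearP /= !antipode_invK.
Qed.
HB.instance Definition _ := GRing.isLinear.Build K A A *:%R T antipode_inv_linear.
Lemma antipode_inv_lB x a : T (iB x *> a) = T a <* iC (SC' x).
Proof. by apply: antipode_inv_eq; rewrite antipode_rC SCinvK antipode_invK. Qed.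
Lemma antipode_inv_rB x a : T (a <* iB x) = iC (SC' x) *> T a.
Proof. by apply: antipode_inv_eq; rewrite antipode_lC SCinvK antipode_invK. Qed.
Lemma antipode_inv_lC y a : T (iC y *> a) = T a <* iB (SB' y).
Proof. by apply: antipode_inv_eq; rewrite antipode_rB SBinvK antipode_invK. Qed.
Lemma antipode_inv_rC y a : T (a <* iC y) = iB (SB' y) *> T a.
Proof. by apply: antipode_inv_eq; rewrite antipode_lB SBinvK antipode_invK. Qed.

Section FactorsT.
Variable w : adfun.
Fact compT_scalar : scalar (fun a => w (T a)).
Proof. by move=> k a b; rewrite !linearP. Qed.
Definition compT := fun a => w (T a).
HB.instance Definition _ := GRing.isLinear.Build K A K *%R compT compT_scalar.
Fact compT_adapted : adapted muB muC compT (Factors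
  (fun a => SC (Cr w (T a))) (fun a => SC (Cl w (T a)))
  (fun a => SB (Br w (T a))) (fun a => SB (Bl w (T a)))).
Proof.
split=> [x a|x a|y a|y a]; rewrite -[LHS]/(w (T _)).
- by rewrite antipode_inv_lB (adCr muCf) (muB_SCr mu_SC).
- by rewrite antipode_inv_rB (adCl muCf) (muB_SCl mu_SC).
- by rewrite antipode_inv_lC (adBr muBf) (muC_SBr mu_SB).
- by rewrite antipode_inv_rC (adBl muBf) (muC_SBl mu_SB).
Qed.
Definition adT : adfun := Adfun compT_adapted.
Lemma adTS a : adT (S a) = w a.
Proof. by rewrite -[LHS]/(w (T _)) (antipode_inv_eq erefl). Qed.
End FactorsT.

(** The factor of phi o S in C is onto because phi_B is, and passing to densities carries it over to
    phi. *)
Lemma phiC_onto y : exists a, Cl phi a = y.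
Proof.
have [a <-] := psi0_Cl_onto y.
have [a' d] := density_exists psi0_right_invariant a.
by exists a'; rewrite -(density_Cl psi0_right_invariant d).
Qed.

(** Fubini for w'(c x_(1)) w(x_(2) b); the next lemma treats w'(b_(1) c) w(x b_(2)). *)
Lemma mul_sliceL_sliceM (w w' : adfun) c b x :
  w' (c ** sliceL w b x) = w (sliceM w' c x ** b).
Proof. by rewrite mul_sliceL (ad_kctr muBf mu_SC) [LHS]mu_epsC_sliceL. Qed.
Lemma sliceE_mul_sliceN (w w' : adfun) c b x :
  w' (sliceE w x b ** c) = w (x ** sliceN w' c b).
Proof.
by rewrite sliceE_mul (ad_fctr muBf mu_SB) [LHS]mu_SB [LHS]mu_epsB_sliceE.
Qed.

(** * Densities with respect to phi *)

Section RightIntegral.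
Variable psi : adfun.
Hypothesis psi_inv : right_invariant psi.

Lemma antipode_sliceM b x : S (sliceM psi b x) = sliceN psi x b.
Proof.
apply: (numul_eqr ndA) => c; rewrite -antipodeE.
apply: (mulS_sliceM (density_eq0 psi_inv)) => p q.
by rewrite [LHS]psi_inv right_invariant_Blr.
Qed.

(** Both sides equal psi(c x_(1)) phi(x_(2) b): the left by strong invariance of psi, the right by
    that of phi. *)
Lemma sliceE_sliceN b c x :
  psi (sliceE (adT phi) (S b) c ** x) = phi (x ** sliceN (adT psi) (S c) b).
Proof.
rewrite sliceE_mul_sliceN -antipode_sliceM -antipodeM adTS -mul_sliceL_sliceM.
by rewrite -sliceE_mul_sliceN -antipode_sliceL -antipodeM adTS.
Qed.

Definition codensity u a := forall x, psi (u ** x) = phi (x ** a).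

Lemma codensityD u a u' a' :
  codensity u a -> codensity u' a' -> codensity (u + u') (a + a').
Proof. by move=> h h' x; rewrite numulDl !linearD /= h h'. Qed.
Lemma codensity0 : codensity 0 0.
Proof. by move=> x; rewrite numul0a !linear0. Qed.

(** The witness is kept as a contraction because [Cr_onto_of_invertible] reads off from it that it
    lies in the span of multiples of values of psi_C. *)
Lemma codensity_exists u : exists t, codensity u (gctr (Bl (adT psi)) t).
Proof.
have PD u1 u2 : (exists t, codensity u1 (gctr (Bl (adT psi)) t)) ->
    (exists t, codensity u2 (gctr (Bl (adT psi)) t)) ->
    exists t, codensity (u1 + u2) (gctr (Bl (adT psi)) t).
  by move=> [t h] [t' h']; exists (t + t'); rewrite linearD; apply: codensityD.
have P0 : exists t, codensity 0 (gctr (Bl (adT psi)) t).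
  by exists 0; rewrite linear0; apply: codensity0.
move: u; apply: (rB_ind P0 PD) => x d.
(* Chosen so that contracting d (x) S(e) by phi o S^-1 multiplies d by exactly x. *)
have [e he] := phiB_onto (SB' (SC' x)).
have -> : d <* iB x = kctr (Cr (adT phi)) (el_r d (S e)).
  rewrite kctrE /= (antipode_inv_eq erefl) -[fac_B_ _ _]/(Bl phi _).
  by rewrite he SBinvK SCinvK.
elim/(DeltaC_r_ind hD): (el_r _ _) => [|t t' ht ht'|c b]; first by rewrite linear0.
  by rewrite linearD; apply: PD.
exists (DeltaB_l (T b) (S c)) => y.
by rewrite -[gctr _ _]/(sliceN _ _ _) -sliceE_sliceN antipode_invK.
Qed.

Lemma codensity_onto : (forall y, exists a, Cr psi a = y) ->
  forall a, exists u, codensity u a.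
Proof.
move=> onto.
have PD a a' : (exists u, codensity u a) -> (exists u, codensity u a') ->
    exists u, codensity u (a + a').
  by move=> [u h] [u' h']; exists (u + u'); apply: codensityD.
have P0 : exists u, codensity u 0 by exists 0; apply: codensity0.
apply: (lC_ind P0 PD) => y e.
have [d hd] := onto (SC' (SB' y)).
have -> : iC y *> e = gctr (Bl (adT psi)) (el_l (S d) e).
  rewrite gctrE /= (antipode_inv_eq erefl) -[fac__C _ _]/(Cr psi _).
  by rewrite hd SCinvK SBinvK.
elim/(DeltaB_l_ind hD): (el_l _ _) => [|t t' ht ht'|c b]; first by rewrite linear0.
  by rewrite linearD; apply: PD.
exists (sliceE (adT phi) (S b) (T c)) => x.
by rewrite sliceE_sliceN antipode_invK.
Qed.

End RightIntegral.

(** For psi = phi o S, a density c of a and a codensity d of c give phi(S(a)S(z)) = phi(zc) =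
    phi(S(z)S(d)), and S is onto. The converse runs the two steps in the other order. *)
Lemma phi_swap_lr u : exists v, forall x, phi (u ** x) = phi (x ** v).
Proof.
have [a <-] := antipode_onto u.
have [c [_ hc]] := density_exists psi0_right_invariant a.
have [d hd] := codensity_onto psi0_right_invariant psi0_Cr_onto c.
exists (S d) => x; have [z <-] := antipode_onto x.
by rewrite -!antipodeM; apply: etrans (hc z) (esym (hd z)).
Qed.
Lemma phi_swap_rl v : exists u, forall x, phi (u ** x) = phi (x ** v).
Proof.
have [d <-] := antipode_onto v.
have [t hd] := codensity_exists psi0_right_invariant d.
have [a [_ ha]] := density_onto psi0_right_invariant psi0_Cl_onto
  (gctr (Bl (adT psi0)) t).
exists (S a) => x; have [z <-] := antipode_onto x.
by rewrite -!antipodeM; apply: etrans (ha z) (esym (hd z)).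
Qed.

(** * The multiplier delta and its invertibility *)

Section RadonNikodym.
Variable psi : adfun.
Hypothesis psi_inv : right_invariant psi.

(** Right multiplication sends a to its density; left multiplication sends c to the codensity of the
    u with phi(u -) = phi(- c). Both phi(x a l(b)) and phi(x r(a) b) equal psi(u x a) for the u
    attached to b, which is the multiplier relation. *)
Lemma delta_exists : exists delta : multiplier A,
  (forall a, density psi a (a <* delta)) /\
  forall u c, (forall x, phi (u ** x) = phi (x ** c)) ->
    codensity psi u (delta *> c).
Proof.
pose r a := sval (cid (density_exists psi_inv a)).
have rP a : density psi a (r a) := svalP (cid (density_exists psi_inv a)).
pose tw c := sval (cid (phi_swap_rl c)).
have twP c x : phi (tw c ** x) = phi (x ** c) := svalP (cid (phi_swap_rl c)) x.
pose l c := gctr (Bl (adT psi)) (sval (cid (codensity_exists psi_inv (tw c)))).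
have lP c : codensity psi (tw c) (l c) :=
  svalP (cid (codensity_exists psi_inv (tw c))).
have rl a b : a ** l b = r a ** b.
  apply: (phi_eqr phi_faithful) => x.
  by rewrite !numulA -lP -twP !numulA (rP a).2.
exists (Multiplier (is_multiplier_lr ndA rl)); split=> // u c h.
have -> : u = tw c by apply: (phi_eql phi_faithful) => x; rewrite h twP.
exact: lP.
Qed.

Variable delta : multiplier A.
Hypothesis delta_r : forall a, density psi a (a <* delta).
Hypothesis delta_l : forall u c, (forall x, phi (u ** x) = phi (x ** c)) ->
  codensity psi u (delta *> c).

(** Fullness of psi makes right multiplication by delta onto through densities and left
    multiplication onto through codensities; sections of the two form the inverse. *)
Lemma delta_invertible : (forall y, exists a, Cl psi a = y) ->
  (forall y, exists a, Cr psi a = y) -> faithful psi -> invertible delta.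
Proof.
move=> Cl_onto Cr_onto psi_f.
have r_onto a' : exists a, a <* delta = a'.
  have [a [_ ha]] := density_onto psi_inv Cl_onto a'.
  exists a; apply: (phi_eqr phi_faithful) => x.
  by rewrite -ha (delta_r a).2.
have l_onto a' : exists c, delta *> c = a'.
  have [u hu] := codensity_onto psi_inv Cr_onto a'; have [c hc] := phi_swap_lr u.
  exists c; apply: (phi_eqr phi_faithful) => x.
  by rewrite -(delta_l hc) hu.
pose r a := sval (cid (r_onto a)); pose l a := sval (cid (l_onto a)).
have rP a : r a <* delta = a := svalP (cid (r_onto a)).
have lP a : delta *> l a = a := svalP (cid (l_onto a)).
have rl a b : a ** l b = r a ** b by rewrite -{1}(rP a) -lrA lP.
(* Linearity of the chosen sections comes from [is_multiplier_lr]. Each product is compared with 1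
   on the side where the section property is immediate. *)
exists (Multiplier (is_multiplier_lr ndA rl)); split.
  exact: (multiplier_eq_l ndA).
exact: (multiplier_eq_r ndA).
Qed.

Section Invertible.
Variable delta' : multiplier A.
Hypotheses (deltaK : delta * delta' = 1) (delta'K : delta' * delta = 1).

Lemma faithful_of_invertible : faithful psi.
Proof.
have psiE a : psi a = phi (a <* delta) by case: (delta_r a).
move=> d d0; split.
  have [[z hz] _] := phi_faithful d0; exists (z <* delta').
  by rewrite psiE -!rmA -raM delta'K.
have : d <* delta != 0.
  by apply: contra_neq d0 => h; rewrite -[d]/(d <* 1) -deltaK raM h linear0.
move=> /phi_faithful[_ [z hz]]; exists z.
by rewrite psiE rmA.
Qed.

Lemma Cl_onto_of_invertible y : exists a, Cl psi a = y.
Proof.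
have [a <-] := phiC_onto y; exists (a <* delta').
by rewrite (density_Cl psi_inv (delta_r _)) -raM delta'K.
Qed.

(** By invertibility every a is delta times an element, hence a codensity, hence a contraction
    involving psi o S^-1. Its value under phi_C is then, up to the anti-isomorphisms, a sum of
    psi_C(S^-1(d)) times elements of C, and phi_C is onto. *)
Lemma Cr_onto_of_invertible y : exists a, Cr psi a = y.
Proof.
have CD y1 y2 : (exists a, Cr psi a = y1) -> (exists a, Cr psi a = y2) ->
    exists a, Cr psi a = y1 + y2.
  by move=> [a <-] [b <-]; exists (a + b); rewrite linearD.
rewrite -(SCK y) -(SBK (SC y)); have [a <-] := phiC_onto (SB (SC y)).
have -> : a = delta *> (delta' *> a) by rewrite -laM deltaK.
have [u hu] := phi_swap_rl (delta' *> a).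
have [t ht] := codensity_exists psi_inv u.
have -> : delta *> (delta' *> a) = gctr (Bl (adT psi)) t.
  by apply: (phi_eqr phi_faithful) => x; rewrite -ht (delta_l hu).
elim/tens_l_ind: t {ht} => [|t t' ht ht'|d e].
- by exists 0; rewrite !linear0.
- by rewrite !linearD; apply: CD.
exists (T d <* iC (SC' (SB' (Cl phi e)))).
by rewrite gctrE lCmapE SB'_anti SBK SC'_anti SCK rCmapE.
Qed.

End Invertible.
End RadonNikodym.

End Bialgebroid.
End QuantumGraphs.

(** Integrality and fullness each quantify over their own factors; faithfulness of the weights
    identifies these. *)
Lemma adapted_unique (K : fieldType) (Q : quantum_graphs K)
    (muB : {scalar qgB Q}) (muC : {scalar qgC Q}) :
  faithful muB -> faithful muC -> forall (w : {scalar qgA Q}) (p p' : factors Q),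
  adapted muB muC w p -> adapted muB muC w p' -> p = p'.
Proof.
move=> muBf muCf w [a1 a2 a3 a4] [b1 b2 b3 b4] [/= h1 h2 h3 h4] [/= k1 k2 k3 k4].
congr Factors; apply/funext => a.
- by apply: (faithful_eqr muBf) => x; rewrite -h1 k1.
- by apply: (faithful_eql muBf) => x; rewrite -h2 k2.
- by apply: (faithful_eqr muCf) => y; rewrite -h3 k3.
- by apply: (faithful_eql muCf) => y; rewrite -h4 k4.
Qed.

Theorem theorem3p5p1 (R : realType) (Q : quantum_graphs R[i])
  (D : multiplier_bialgebroid Q) (hD : regular_multiplier_hopf_algebroid D)
  (epsB : qgA Q -> qgB Q) (hepsB : left_counit D epsB)
  (epsC : qgA Q -> qgC Q) (hepsC : right_counit D epsC)
  (muB : {scalar qgB Q}) (muC : {scalar qgC Q})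
  (hmu : base_weight epsB epsC muB muC)
  (phi : {scalar qgA Q}) (hphi : full_left_integral D muB muC phi)
  (phi_faithful : faithful phi)
  (psi : {scalar qgA Q}) (hpsi : right_integral D muB muC psi) :
  exists delta : multiplier (qgA Q),
    unique (fun m : multiplier (qgA Q) => forall a, psi a = phi (a <* m)) delta /\
    (invertible delta <-> full_right_integral D muB muC psi /\ faithful psi).
Proof.
have [muBf muCf] := (muB_faithful hmu, muC_faithful hmu).
have [[p phi_ad p_inv] [p' /(adapted_unique muBf muCf phi_ad) <-]] := hphi.
case=> Bl_onto Br_onto; have [q psi_ad q_inv] := hpsi.
pose phi' := Adfun phi_ad; pose psi' := Adfun psi_ad.
have phi'_f : faithful phi' := phi_faithful.
have phi'_inv : left_invariant D hmu phi' := p_inv.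
have psi'_inv : right_invariant D hmu psi' := q_inv.
have [delta [delta_r delta_l]] := delta_exists hD hepsB hepsC
  phi'_f phi'_inv Bl_onto Br_onto psi'_inv.
exists delta; split.
  split=> [a|m hm]; first exact: (delta_r a).1.
  (* Multipliers with the same right action are equal, and the right action is determined by
     phi(x(am)) = psi(xa). *)
  apply: (multiplier_eq_r (@qg_nondegenerate _ Q)) => a.
  apply: (faithful_eqr phi_faithful) => x.
  by apply: (etrans (esym ((delta_r a).2 x))); rewrite -rmA -hm.
split=> [[delta' [dK d'K]]|[[_ [q' /(adapted_unique muBf muCf psi_ad) <-]]]].
- split; last exact: (faithful_of_invertible phi'_f delta_r dK d'K).
  split=> //; exists q => //; split.
    exact: (Cl_onto_of_invertible hD hepsB hepsC phi'_f phi'_inv Bl_onto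
      Br_onto psi'_inv delta_r d'K).
  exact: (Cr_onto_of_invertible hD hepsB hepsC phi'_f phi'_inv Bl_onto
    Br_onto psi'_inv delta_l dK).
case=> Cl_onto Cr_onto psi_f.
exact: (delta_invertible hD hepsB hepsC phi'_f phi'_inv Bl_onto Br_onto
  psi'_inv delta_r delta_l Cl_onto Cr_onto psi_f).
Qed.
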